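(* Let $\mathcal C$ be a finite index set, let $w_c>0$ with $\sum_{c\in\mathcal C}w_c=1$, and let $p=\sum_{c\in\mathcal C}w_cp_c$, where each $p_c$ is a probability density on $\mathbb{R}^d$ and $p$ has a continuously differentiable density. Suppose each $p_c$ satisfies the Poincaré inequality with the same constant $C_{\mathrm P}$: $$\operatorname{Var}_{p_c}(f)\le C_{\mathrm P}\int\|\nabla f(x)\|^2\,p_c(dx)\qquad\text{for all smooth } f.$$ Let $T>0$, $\alpha=e^{-T}$, and let $P$ be the Markov kernel on $\mathbb{R}^d$ which, from the current state $X_0$, draws $X_T\sim\mathcal N(\sqrt\alpha X_0,(1-\alpha)I_d)$ and then draws the next state from the conditional law of $X_0$ given $X_T$, where in the joint law $X_0\sim p$. Then $$\mathrm{Gap}(P)\ge\exp\Big\{-\frac{\alpha}{4(1-\alpha)}\max_{c,c'\in\mathcal C}W_2^2(p_c,p_{c'})\Big\}\,\frac{1-\alpha}{1-\alpha+\alpha C_{\mathrm P}} .$$ In particular, the lower bound is uniform over the mixture weights $(w_c)_{c\in\mathcal C}$.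
   Context: $W_2$ is the 2-Wasserstein distance with Euclidean cost. With $(Pf)(x)=\int f(y)P(x,dy)$, the spectral gap is $$\mathrm{Gap}(P)=1-\sup_{f\in L^2(p),\ \mathbb E_{p}[f]=0,\ f\ne0}\frac{\langle f,Pf\rangle_{L^2(p)}}{\|f\|^2_{L^2(p)}} .$$ *)

(* Defs.v *)
From HB Require Import structures.
From mathcomp Require Import all_boot all_order all_algebra.
From mathcomp Require Import all_classical all_reals all_analysis.
From mathcomp Require Import measurable_realfun.

Set Implicit Arguments.
Unset Strict Implicit.
Unset Printing Implicit Defensive.

Import Order.TTheory GRing.Theory Num.Theory.
Import numFieldNormedType.Exports.

Local Open Scope classical_set_scope.
Local Open Scope ring_scope.

Definition measure_rV_display : measure_display.
Proof. exact: default_measure_display. Qed.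

Section rV_measurable.
Context {R : realType} (n : nat).

Let borel : set (set 'rV[R]_n) := <<s open >>.

Let borel0 : borel set0. Proof. exact: sigma_algebra0. Qed.

Let borelC A : borel A -> borel (~` A). Proof. exact: sigma_algebraC. Qed.

Let borelU (F : (set 'rV[R]_n)^nat) :
  (forall i, borel (F i)) -> borel (\bigcup_i F i).
Proof. exact: sigma_algebra_bigcup. Qed.

HB.instance Definition _ := @isMeasurable.Build measure_rV_display
  'rV[R]_n borel borel0 borelC borelU.

End rV_measurable.

Section rV_measurable_lemmas.
Context {R : realType}.

Lemma open_measurable_rV n (A : set 'rV[R]_n) : open A -> measurable A.
Proof. by move=> oA; exact: sub_sigma_algebra. Qed.

Lemma continuous_measurable_rV n (f : 'rV[R]_n -> R) :
  continuous f -> measurable_fun [set: 'rV[R]_n] f.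
Proof.
move=> cf; apply: (measurability _ (RGenOpens.measurableE R)).
move=> _ [_ [x [y ->]] <-]; rewrite setTI; apply: open_measurable_rV.
by apply: open_comp; [move=> ? _; exact: cf|exact: interval_open].
Qed.

Lemma measurable_coord n (i : 'I_n) :
  measurable_fun [set: 'rV[R]_n] (fun x => x ord0 i).
Proof. by apply: continuous_measurable_rV => x; exact: coord_continuous. Qed.

Lemma rV_ball_rat n (A : set 'rV[R]_n) (x : 'rV[R]_n) : open A -> A x ->
  exists qk : 'rV[rat]_n * nat,
    let B := [set y : 'rV[R]_n |
      forall i, ball (ratr (qk.1 ord0 i) : R) (qk.2.+1%:R^-1 : R) (y ord0 i)] in
    B `<=` A /\ B x.
Proof.
move=> oA Ax.
have /nbhs_ballP[e /= e0 eA] : nbhs x A by exact: open_nbhs_nbhs.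
have [k kltn] : exists k, (k.+1%:R^-1 : R) < e / 2.
  have e20 : 0 < e / 2 by rewrite divr_gt0.
  by have [k] := ltr_add_invr e20; rewrite add0r => ?; exists k.
have qP i : exists q : rat, ball (x ord0 i) (k.+1%:R^-1 : R) (ratr q).
  have /= := @dense_rat R (ball (x ord0 i) (k.+1%:R^-1 : R)).
  case.
  - by exists (x ord0 i); apply: ballxx; rewrite invr_gt0.
  - exact: ball_open.
  - by move=> y [xq [q _ qE]]; exists q; rewrite qE.
pose q := \row_i projT1 (cid (qP i)).
exists (q, k) => /=; split => [y yB|i]; last first.
  by rewrite mxE; case: cid => /= ? /ball_sym.
apply: eA; split => // i j; rewrite (ord1 i) [e]splitr.
apply: (@ball_triangle _ _ (ratr (q ord0 j) : R)).
  by apply: (le_ball (ltW kltn)); rewrite mxE; case: cid.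
exact/(le_ball (ltW kltn))/yB.
Qed.

Lemma measurable_fun_rV d (T : measurableType d) n (f : T -> 'rV[R]_n) :
  (forall i, measurable_fun [set: T] (fun x => f x ord0 i)) ->
  measurable_fun [set: T] f.
Proof.
move=> mf; apply: (measurability (@open 'rV[R]_n)) => //.
move=> _ [A oA <-]; rewrite setTI.
pose B (qk : 'rV[rat]_n * nat) := [set y : 'rV[R]_n |
  forall i, ball (ratr (qk.1 ord0 i) : R) (qk.2.+1%:R^-1 : R) (y ord0 i)].
have -> : f @^-1` A =
    \bigcup_qk (if `[< B qk `<=` A >] then f @^-1` (B qk) else set0).
  apply/seteqP; split => [x /= Afx|x [qk _]].
    have [qk [BA Bx]] := rV_ball_rat oA Afx.
    by exists qk => //; case: asboolP.
  by case: asboolP => // BA /BA.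
apply: countable_bigcupT_measurable => [|qk]; first exact: countableP.
case: ifP => // _.
have -> : f @^-1` (B qk) = \bigcap_(i in [set: 'I_n])
    ((fun x => f x ord0 i) @^-1` ball (ratr (qk.1 ord0 i) : R) (qk.2.+1%:R^-1 : R)).
  by apply/seteqP; split => x /= h i; [move=> _|]; exact: h.
apply: fin_bigcap_measurable => // i _; rewrite -[X in measurable X]setTI.
by apply: mf => //; apply: open_measurable; exact: ball_open.
Qed.

End rV_measurable_lemmas.

Section lebesgue_rV.
Context {R : realType}.

Definition cons_rV n (z : measurableTypeR R * 'rV[R]_n) : 'rV[R]_n.+1 :=
  \row_i (if unlift ord0 i is Some j then z.2 ord0 j else z.1).

Lemma cons_rV0 n (z : measurableTypeR R * 'rV[R]_n) : cons_rV z ord0 ord0 = z.1.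
Proof. by rewrite mxE unlift_none. Qed.

Lemma cons_rVS n (z : measurableTypeR R * 'rV[R]_n) j : cons_rV z ord0 (lift ord0 j) = z.2 ord0 j.
Proof. by rewrite mxE liftK. Qed.

Lemma measurable_cons_rV n : measurable_fun [set: measurableTypeR R * 'rV[R]_n] (@cons_rV n).
Proof.
apply: measurable_fun_rV => i; case: (unliftP ord0 i) => [j ->|->].
  under eq_fun do rewrite cons_rVS.
  by apply: (measurableT_comp (measurable_coord j)); exact: measurable_snd.
by under eq_fun do rewrite cons_rV0; exact: measurable_fst.
Qed.

Definition uncons_rV n (x : 'rV[R]_n.+1) : measurableTypeR R * 'rV[R]_n :=
  (x ord0 ord0, \row_j x ord0 (lift ord0 j)).

Lemma cons_rVK n : cancel (@cons_rV n) (@uncons_rV n).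
Proof.
move=> [a y]; rewrite /uncons_rV cons_rV0; congr pair.
by apply/rowP => j; rewrite mxE cons_rVS.
Qed.

Lemma measurable_uncons_rV n : measurable_fun [set: 'rV[R]_n.+1] (@uncons_rV n).
Proof.
apply: measurable_fun_pair; first exact: measurable_coord.
apply: measurable_fun_rV => j; under eq_fun do rewrite mxE.
exact: measurable_coord.
Qed.

End lebesgue_rV.

Section lebesgue_rV_succ.
Context {R : realType} (n : nat).
Variable mu : {sigma_finite_measure set 'rV[R]_n -> \bar R}.

Definition lebesgue_rV_succ : set 'rV[R]_n.+1 -> \bar R :=
  pushforward (@lebesgue_measure R \x mu)%E (@cons_rV R n).

Let mcons (A : set 'rV[R]_n.+1) :
  measurable A -> measurable (@cons_rV R n @^-1` A).
Proof.
by move=> mA; rewrite -[X in measurable X]setTI; exact: measurable_cons_rV.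
Qed.

Let succ0 : lebesgue_rV_succ set0 = 0%E.
Proof. by rewrite /lebesgue_rV_succ /pushforward preimage_set0 measure0. Qed.

Let succ_ge0 A : (0 <= lebesgue_rV_succ A)%E.
Proof. exact: (measure_ge0 (@lebesgue_measure R \x mu)%E). Qed.

Let succ_sigma_additive : semi_sigma_additive lebesgue_rV_succ.
Proof.
move=> F mF tF mUF; rewrite /lebesgue_rV_succ /pushforward preimage_bigcup.
apply: measure_semi_sigma_additive.
- by move=> i; exact: mcons.
- apply/trivIsetP => /= i j _ _ ij; rewrite -preimage_setI.
  by move/trivIsetP : tF => /(_ _ _ _ _ ij) ->//; rewrite preimage_set0.
- by rewrite -preimage_bigcup; exact: mcons.
Qed.

HB.instance Definition _ := isMeasure.Build _ _ _ lebesgue_rV_succ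
  succ0 succ_ge0 succ_sigma_additive.

Let succ_sigma_finite : sigma_finite setT lebesgue_rV_succ.
Proof.
have [G GT Goo] : sigma_finite setT (@lebesgue_measure R \x mu)%E.
  have /sigma_finiteP[F [TF ndF Foo]] := sigma_finiteT (@lebesgue_measure R).
  have /sigma_finiteP[G [TG ndG Goo]] := sigma_finiteT mu.
  exists (fun k => F k `*` G k).
    rewrite -setXTT TF TG; apply/seteqP; split => [[x y]|[x y] [k _ [/= ? ?]]].
      move=> [/= [i _ Fix] [j _ Gjy]]; exists (maxn i j) => //; split.
      - by move: x Fix; exact/subsetPset/ndF/leq_maxl.
      - by move: y Gjy; exact/subsetPset/ndG/leq_maxr.
    by split; exists k.
  move=> k; have [? ?] := Foo k; have [? ?] := Goo k.
  split; first exact: measurableX.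
  by rewrite product_measure1E// lte_mul_pinfty// ge0_fin_numE.
exists (fun k => @uncons_rV R n @^-1` G k).
  by rewrite -preimage_bigcup -GT preimage_setT.
move=> k; have [mG muG] := Goo k; split.
  by rewrite -[X in measurable X]setTI; exact: measurable_uncons_rV.
rewrite /lebesgue_rV_succ /pushforward -comp_preimage.
by rewrite (_ : _ \o _ = id)//; apply/funext => z /=; rewrite cons_rVK.
Qed.

HB.instance Definition _ := Measure_isSigmaFinite.Build _ _ _ lebesgue_rV_succ
  succ_sigma_finite.

End lebesgue_rV_succ.

(* R^(m+1) is identified with R * R^m through [cons_rV]. *)
Fixpoint lebesgue_rV {R : realType} (n : nat) :
    {sigma_finite_measure set 'rV[R]_n -> \bar R} :=
  match n with
  | 0 => dirac (0 : 'rV[R]_0)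
  | m.+1 => lebesgue_rV_succ (lebesgue_rV m)
  end.

Lemma ge0_integral_lebesgue_rVS {R : realType} n (f : 'rV[R]_n.+1 -> \bar R) :
    measurable_fun [set: 'rV[R]_n.+1] f -> (forall x, 0 <= f x)%E ->
  (\int[lebesgue_rV n.+1]_x f x =
   \int[@lebesgue_measure R]_a \int[lebesgue_rV n]_y f (cons_rV (a, y)))%E.
Proof.
move=> mf f0.
transitivity (\int[@lebesgue_measure R \x lebesgue_rV n]_z f (cons_rV z))%E.
  rewrite -[in RHS](preimage_setT (@cons_rV R n)).
  apply: (ge0_integral_pushforward (@measurable_cons_rV R n)) => //.
apply: (@fubini_tonelli1 _ _ _ _ _ _ _ (f \o @cons_rV R n)) => [|z].
  exact: (measurableT_comp mf (@measurable_cons_rV R n)).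
exact: f0.
Qed.

Section normal_rV.
Context {R : realType} (n : nat).
Implicit Types (m : 'rV[R]_n) (s : R).

(* Density of N(m, s^2 I_n), a product since the covariance is diagonal; as for
   [normal_pdf], [s] is the standard deviation. *)
Definition normal_rV_pdf m s (y : 'rV[R]_n) : R :=
  \prod_(i < n) normal_pdf (m ord0 i) s (y ord0 i).

Lemma normal_rV_pdf_ge0 m s y : 0 <= normal_rV_pdf m s y.
Proof. by apply: prodr_ge0 => i _; exact: normal_pdf_ge0. Qed.

Lemma measurable_normal_rV_pdf m s :
  measurable_fun [set: 'rV[R]_n] (normal_rV_pdf m s).
Proof.
apply: measurable_prod => i _.
apply: (measurableT_comp (measurable_normal_pdf _ _)).
exact: measurable_coord.
Qed.

Definition normal_rV m s : set 'rV[R]_n -> \bar R :=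
  fun A => (\int[lebesgue_rV n]_(y in A) (normal_rV_pdf m s y)%:E)%E.

End normal_rV.

Lemma integral_normal_rV_pdf {R : realType} n (m : 'rV[R]_n) s :
  (\int[lebesgue_rV n]_y (normal_rV_pdf m s y)%:E = 1)%E.
Proof.
elim: n m => [|n IHn] m.
  rewrite /= integral_dirac//; first by rewrite diracT mul1e /normal_rV_pdf big_ord0.
  by apply/measurable_EFinP; exact: measurable_normal_rV_pdf.
rewrite ge0_integral_lebesgue_rVS; last 2 first.
- by apply/measurable_EFinP; exact: measurable_normal_rV_pdf.
- by move=> x; rewrite lee_fin normal_rV_pdf_ge0.
have pdfE a (y : 'rV[R]_n) : normal_rV_pdf m s (cons_rV (a, y)) =
    normal_pdf (m ord0 ord0) s a *
    normal_rV_pdf (\row_j m ord0 (lift ord0 j)) s y.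
  rewrite /normal_rV_pdf big_ord_recl cons_rV0; congr (_ * _).
  by apply: eq_bigr => i _; rewrite cons_rVS mxE.
rewrite -(integral_normal_pdf (m ord0 ord0) s).
apply: eq_integral => a _; under eq_integral do rewrite pdfE EFinM.
rewrite ge0_integralZl ?IHn ?mule1 ?lee_fin ?normal_pdf_ge0//.
  by apply/measurable_EFinP; exact: measurable_normal_rV_pdf.
by move=> y _; rewrite lee_fin normal_rV_pdf_ge0.
Qed.

Section normal_rV_probability.
Context {R : realType} (n : nat) (m : 'rV[R]_n) (s : R).

Let normal0 : normal_rV m s set0 = 0%E.
Proof. by rewrite /normal_rV integral_set0. Qed.

Let normal_ge0 A : (0 <= normal_rV m s A)%E.
Proof. by apply: integral_ge0 => x _; rewrite lee_fin normal_rV_pdf_ge0. Qed.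

Let normal_sigma_additive : semi_sigma_additive (normal_rV m s).
Proof.
move=> A mA tA mUA; rewrite /normal_rV ge0_integral_bigcup//; last 2 first.
- by apply/measurable_funTS/measurable_EFinP; exact: measurable_normal_rV_pdf.
- by move=> x _; rewrite lee_fin normal_rV_pdf_ge0.
apply: is_cvg_ereal_nneg_natsum_cond => k _ _.
by apply: integral_ge0 => x _; rewrite lee_fin normal_rV_pdf_ge0.
Qed.

HB.instance Definition _ := isMeasure.Build _ _ _ (normal_rV m s)
  normal0 normal_ge0 normal_sigma_additive.

Let normal_setT : normal_rV m s [set: _] = 1%E.
Proof. exact: integral_normal_rV_pdf. Qed.

HB.instance Definition _ := Measure_isProbability.Build _ _ _
  (normal_rV m s) normal_setT.

End normal_rV_probability.

Section normal_kernel.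
Context {R : realType} (n : nat) (c s : R).

Definition normal_kernel (x : 'rV[R]_n) : {measure set 'rV[R]_n -> \bar R} :=
  normal_rV (c *: x) s.

Let measurable_pdf2 : measurable_fun [set: 'rV[R]_n * 'rV[R]_n]
  (fun xy => normal_rV_pdf (c *: xy.1) s xy.2).
Proof.
apply: measurable_prod => i _; rewrite /normal_pdf.
have m1 : measurable_fun setT (fun xy : 'rV[R]_n * 'rV[R]_n => xy.1 ord0 i).
  by apply: (measurableT_comp (measurable_coord i)); exact: measurable_fst.
have m2 : measurable_fun setT (fun xy : 'rV[R]_n * 'rV[R]_n => xy.2 ord0 i).
  by apply: (measurableT_comp (measurable_coord i)); exact: measurable_snd.
case: (s == 0).
  by apply: (measurableT_comp (measurable_indic _) m2).
apply: measurable_funM => //; rewrite /normal_fun.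
apply: measurableT_comp => //; apply: measurable_funM => //.
apply: measurableT_comp => //; apply: measurable_funX.
apply: measurable_funB => //; under eq_fun do rewrite mxE.
exact: measurable_funM.
Qed.

Let measurable_normal_kernel U : measurable U ->
  measurable_fun [set: 'rV[R]_n] (normal_kernel ^~ U).
Proof.
move=> mU; pose f (xy : 'rV[R]_n * 'rV[R]_n) :=
  ((\1_U xy.2)%:E * (normal_rV_pdf (c *: xy.1) s xy.2)%:E)%E.
have f0 xy : (0 <= f xy)%E.
  by rewrite /f mule_ge0// lee_fin// normal_rV_pdf_ge0.
have mf : measurable_fun [set: 'rV[R]_n * 'rV[R]_n] f.
  apply: emeasurable_funM; apply/measurable_EFinP => //.
  by apply: (measurableT_comp (measurable_indic mU)); exact: measurable_snd.
have := @measurable_fun_fubini_tonelli_F _ _ _ _ _ (lebesgue_rV n) f mf f0.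
congr measurable_fun; apply/funext => x.
rewrite /normal_kernel /= /normal_rV integral_mkcond; apply: eq_integral => y _.
by rewrite patchE /f indicE; case: ifP; rewrite ?mul1e ?mul0e.
Qed.

HB.instance Definition _ := isKernel.Build _ _ _ _ _ normal_kernel
  measurable_normal_kernel.

Let normal_kernel_setT x : normal_kernel x [set: _] = 1%E.
Proof. exact: integral_normal_rV_pdf. Qed.

HB.instance Definition _ := Kernel_isProbability.Build _ _ _ _ _ normal_kernel
  normal_kernel_setT.

End normal_kernel.

Section density.
Context {R : realType} (n : nat).

Definition is_density (q : 'rV[R]_n -> R) (p : probability 'rV[R]_n R) : Prop :=
  [/\ measurable_fun [set: 'rV[R]_n] q, forall x, 0 <= q x &
      forall A, measurable A ->
        p A = (\int[lebesgue_rV n]_(x in A) (q x)%:E)%E].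

End density.

Section euclidean.
Context {R : realType} (n : nat).
Implicit Types (f : 'rV[R]_n -> R) (x : 'rV[R]_n).

(* The library norm on ['rV[R]_n] is the sup norm. *)
Definition enorm x : R := Num.sqrt (\sum_(i < n) x ord0 i ^+ 2).

Definition partial (i : 'I_n) f : 'rV[R]_n -> R :=
  fun x => 'D_(delta_mx ord0 i) f x.

Definition gradient f x : 'rV[R]_n := \row_i partial i f x.

Definition partials (s : seq 'I_n) f : 'rV[R]_n -> R := foldr partial f s.

Definition class_C (k : nat) f : Prop :=
  (forall s, (size s <= k)%N -> continuous (partials s f)) /\
  (forall s, (size s < k)%N ->
     forall (i : 'I_n) x, derivable (partials s f) x (delta_mx ord0 i)).

Definition smooth f : Prop := forall k, class_C k f.

(* The requirement f in L^2(p) makes the variance meaningful. *)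
Definition poincare (p : probability 'rV[R]_n R) (C : R) : Prop :=
  forall f, smooth f -> f \in Lfun p 2%:E ->
  ('V_p[f] <= C%:E * \int[p]_x (enorm (gradient f x) ^+ 2)%:E)%E.

End euclidean.

Section wasserstein.
Context {R : realType} (n : nat).
Implicit Types mu nu : probability 'rV[R]_n R.

Definition coupling mu nu (g : probability ('rV[R]_n * 'rV[R]_n)%type R) : Prop :=
  forall A, measurable A ->
    g (fst @^-1` A) = mu A /\ g (snd @^-1` A) = nu A.

Definition wasserstein2 mu nu : \bar R :=
  ((ereal_inf [set \int[g]_z (enorm (z.1 - z.2) ^+ 2)%:E
    | g in coupling mu nu]) `^ (2^-1))%E.

End wasserstein.

Section spectral_gap.
Context d (T : measurableType d) (R : realType).

Definition kernel_op (P : T -> {measure set T -> \bar R}) (f : T -> R) : T -> R :=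
  fun x => \int[P x]_y f y.

Definition L2_inner (p : probability T R) (f g : T -> R) : R :=
  \int[p]_x (f x * g x).

(* [f] ranges over representatives, so [f != 0] in L^2(p) reads: [f] is not
   p-almost everywhere 0. *)
Definition spectral_gap (p : probability T R)
    (P : T -> {measure set T -> \bar R}) : \bar R :=
  (1 - ereal_sup [set (L2_inner p f (kernel_op P f) / L2_inner p f f)%:E
    | f in [set f : T -> R | [/\ f \in Lfun p 2%:E, 'E_p[f] = 0 &
                               ~ {ae p, forall x, f x = 0%R}]]])%E.

End spectral_gap.

Definition is_mixture d (T : measurableType d) (R : realType) (I : finType)
    (w : I -> R) (pc : I -> probability T R) (p : probability T R) : Prop :=
  forall A, measurable A -> p A = (\sum_(c : I) (w c)%:E * pc c A)%E.

(** For X ~ p and Y | X = x ~ Q x, the kernel [K] is a regular conditional law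
    of X given Y: P(X in A, Y in B) = E[1_B(Y) K(Y, A)]. *)
Definition is_conditional_law d d' (T : measurableType d) (T' : measurableType d')
    (R : realType) (p : probability T R) (Q : R.-pker T ~> T')
    (K : R.-pker T' ~> T) : Prop :=
  forall A B, measurable A -> measurable B ->
    (\int[p]_(x in A) Q x B = \int[p]_x \int[Q x]_(y in B) K y A)%E.

(* Main.v *)
Require Import Defs.
From mathcomp Require Import all_boot all_order all_algebra.
From mathcomp Require Import all_classical all_reals all_analysis.
From mathcomp Require Import measurable_realfun finmap ring lra.

(** Let [a = sqrt alpha], [s = sqrt (1 - alpha)], let [Q] be the Gaussian kernel
    from [X_0] to [X_T] and [P = Q K].  By disintegration [<f, P f>] is the
    squared norm of [K f], and Cauchy-Schwarz reduces the claim to the reversed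
    chain: [E_p Var (g(X_T) | X_0) >= B Var g(X_T)] for bounded [g], where [B] is
    the announced bound.  The function [h = Q g] does not depend on the
    mixture; it is smooth, and Bessel's inequality for the normalised
    coordinates gives [|grad h|^2 <= (a/s)^2 Var (g(X_T) | X_0)], so that the
    Poincare inequality of [p_c] yields
    [E_c Var (g(X_T) | X_0) >= kappa Var_c g(X_T)] with
    [kappa = (1 - alpha) / (1 - alpha + alpha CP)] on every component.
    Finally [sum_c w_c Var_c g(X_T) >= r^2 Var g(X_T)] as soon as all Hellinger
    affinities of the noised components are at least [r]; a coupling and
    Jensen's inequality bound these affinities below by
    [exp (- alpha W_2^2 / (8 (1 - alpha)))]. *)

Set Implicit Arguments.
Unset Strict Implicit.
Unset Printing Implicit Defensive.

Import Order.TTheory GRing.Theory Num.Theory.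
Import numFieldNormedType.Exports.

Local Open Scope classical_set_scope.
Local Open Scope ring_scope.

(** * Integral functionals *)

(** The weights disappear for the following reason. Comparing a mixture with its components usually
    costs the smallest weight. Here each component receives a free centre [u c], and the squared
    differences of centres are summed over pairs with weight [w c * w c']. That sum is exactly twice
    the variance of the centres, so only the affinities enter. One factor [r] comes from Young's
    inequality and the other from the affinity, whence [r ^+ 2]. Two Gaussians with means ax, ax'
    and covariance s^2 I have affinity exp(-a^2 |x - x'|^2 / (8 s^2)), and squaring turns 8 into the
    announced 4. The constant kappa appears when E_c Var(g(X_T) | X_0) is added to both sides of the
    Poincare bound on Var_c h. Two constraints shape the rest. [poincare] asks for continuity of all
    iterated partials, so h is placed in a family of polynomial-Gaussian convolutions closed under
    partial derivatives. Estimates are made for bounded functions and stay in variance form until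
    truncation reaches L^2, because truncation destroys the condition E f = 0. *)

Section daniell.
Context d (T : measurableType d) (R : realType).
Local Open Scope ereal_scope.
Implicit Types (f g : T -> \bar R) (L : (T -> \bar R) -> \bar R).

(** Stated for functionals rather than measures, so that iterated integrals, densities, images and
    weighted sums are all compared without constructing the corresponding measures. *)
Definition daniell L : Prop :=
  [/\ forall f g, measurable_fun setT f -> measurable_fun setT g ->
        (forall x, 0 <= f x) -> (forall x, 0 <= g x) ->
        L (f \+ g) = L f + L g,
      forall (k : R) f, (0 <= k)%R -> measurable_fun setT f ->
        (forall x, 0 <= f x) -> L (fun x => k%:E * f x) = k%:E * L f &
      forall (f_ : (T -> \bar R)^nat) f,
        (forall n, measurable_fun setT (f_ n)) ->
        (forall n x, 0 <= f_ n x) ->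
        (forall x, nondecreasing_seq (f_ ^~ x)) ->
        (forall x, f_ ^~ x @ \oo --> f x) -> L \o f_ @ \oo --> L f].

Import HBNNSimple.

(** Agreement on indicators passes to simple functions by additivity and homogeneity, then to all
    nonnegative measurable functions along an increasing simple approximation. *)
Lemma daniell_eq L1 L2 : daniell L1 -> daniell L2 ->
  (forall A, measurable A ->
    L1 (fun x => (\1_A x)%:E) = L2 (fun x => (\1_A x)%:E)) ->
  forall f, measurable_fun setT f -> (forall x, 0 <= f x) -> L1 f = L2 f.
Proof.
move=> [D1 Z1 M1] [D2 Z2 M2] L12 f mf f0.
have Lnn (h : {nnsfun T >-> R}) : L1 (EFin \o h) = L2 (EFin \o h).
  (* On the range of [h] the maximum is [y] itself; it keeps every coefficient nonnegative once the
     range is generalised to an arbitrary list for the induction. *)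
  have -> : EFin \o h = fun x => \sum_(y <- fset_set (range h))
      (Num.max y 0)%:E * (\1_(h @^-1` [set y]) x)%:E.
    apply/funext => x /=; rewrite [in LHS]fimfunE fsbig_finite//=.
    rewrite -sumEFin !big_seq; apply: eq_bigr => y.
    rewrite in_fset_set// => /set_mem[z _ <-].
    by rewrite (max_idPl _)// EFinM.
  elim: (fset_set _ : seq R) => [|y s IH].
    (* [daniell] does not list the value at 0; it follows from homogeneity with factor 0. *)
    have -> : (fun x => \sum_(y <- [::])
      (Num.max y 0)%:E * (\1_(h @^-1` [set y]) x)%:E) = fun x => 0%:E * (\1_set0 x)%:E.
      by apply/funext => x; rewrite big_nil mul0e.
    have m0 : measurable_fun setT (fun x : T => (\1_set0 x)%:E : \bar R).
      by apply/measurable_EFinP; exact: measurable_indic.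
    have g0 (x : T) : 0 <= (\1_set0 x : R)%:E by rewrite lee_fin.
    by rewrite Z1// Z2// !mul0e.
  have -> : (fun x => \sum_(j <- y :: s)
      (Num.max j 0)%:E * (\1_(h @^-1` [set j]) x)%:E) =
    (fun x => (Num.max y 0)%:E * (\1_(h @^-1` [set y]) x)%:E) \+
    (fun x => \sum_(j <- s) (Num.max j 0)%:E * (\1_(h @^-1` [set j]) x)%:E).
    by apply/funext => x; rewrite big_cons.
  have m1 j : measurable_fun setT
      (fun x => (Num.max j 0)%:E * (\1_(h @^-1` [set j]) x)%:E).
    by apply: emeasurable_funM => //; apply/measurable_EFinP; exact: measurable_indic.
  have g1 j x : 0 <= (Num.max j 0)%:E * (\1_(h @^-1` [set j]) x)%:E.
    by rewrite mule_ge0// lee_fin ?le_max ?lexx ?orbT.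
  have m2 : measurable_fun setT (fun x => \sum_(j <- s) (Num.max j 0)%:E * (\1_(h @^-1` [set j]) x)%:E).
    by apply: emeasurable_sum.
  have g2 x : 0 <= \sum_(j <- s) (Num.max j 0)%:E * (\1_(h @^-1` [set j]) x)%:E.
    by apply: sume_ge0 => j _.
  rewrite D1// D2// IH; congr (_ + _).
  have my : measurable (h @^-1` [set y]) by [].
  have mi : measurable_fun setT (fun x : T => (\1_(h @^-1` [set y]) x)%:E : \bar R).
    by apply/measurable_EFinP; exact: measurable_indic.
  have y0 : (0 <= Num.max y 0)%R by rewrite le_max lexx orbT.
  have gi x : 0 <= (\1_(h @^-1` [set y]) x)%:E :> \bar R by rewrite lee_fin.
  by rewrite Z1// Z2// L12.
pose f_ := nnsfun_approx measurableT mf.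
have mf_ n : measurable_fun setT (EFin \o f_ n) by exact/measurable_EFinP.
have f0_ n x : 0 <= (EFin \o f_ n) x by rewrite lee_fin.
have nd x : nondecreasing_seq ((fun n => EFin \o f_ n) ^~ x).
  by move=> a b ab; rewrite lee_fin; exact/lefP/nd_nnsfun_approx.
have cf x : (fun n => EFin \o f_ n) ^~ x @ \oo --> f x.
  by apply: cvg_nnsfun_approx => //.
have c1 := M1 _ _ mf_ f0_ nd cf.
have c2 := M2 _ _ mf_ f0_ nd cf.
have e : L1 \o (fun n => EFin \o f_ n) = L2 \o (fun n => EFin \o f_ n).
  by apply/funext => n /=; rewrite Lnn.
rewrite e in c1.
by apply: (cvg_unique _ c1 c2).
Qed.

Lemma daniell_integral (mu : {measure set T -> \bar R}) :
  daniell (fun f => \int[mu]_x f x).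
Proof.
split.
- by move=> f g mf mg f0 g0; rewrite ge0_integralD.
- by move=> k f k0 mf f0; rewrite ge0_integralZl_EFin.
- move=> f_ f mf f0 nd cf.
  have -> : (\int[mu]_x f x) = (\int[mu]_x limn (f_ ^~ x)).
    by apply: eq_integral => x _; apply/esym/cvg_lim.
  apply: cvg_monotone_convergence => // n x _; exact: f0.
Qed.

Lemma daniell_mul L g : daniell L -> measurable_fun setT g ->
  (forall x, 0 <= g x) -> (forall x, g x \is a fin_num) ->
  daniell (fun f => L (fun x => g x * f x)).
Proof.
move=> [D Z M] mg g0 gfin; split.
- move=> f h mf mh f0 h0; rewrite -D//.
  + by congr L; apply/funext => x /=; rewrite ge0_muleDr.
  + exact: emeasurable_funM.
  + exact: emeasurable_funM.
  + by move=> x; rewrite mule_ge0.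
  + by move=> x; rewrite mule_ge0.
- move=> k f k0 mf f0; rewrite -Z//.
  + by congr L; apply/funext => x /=; rewrite muleCA.
  + exact: emeasurable_funM.
  + by move=> x; rewrite mule_ge0.
- move=> f_ f mf f0 nd cf.
  apply: (M (fun n x => g x * f_ n x)) => //.
  + by move=> n; exact: emeasurable_funM.
  + by move=> n x; rewrite mule_ge0.
  + by move=> x a b ab; rewrite lee_wpmul2l//; exact: nd.
  + move=> x; apply: cvgeZl => //; exact: cf.
Qed.

End daniell.

Section daniell_kernel.
Context d d' (X : measurableType d) (Y : measurableType d') (R : realType).
Local Open Scope ereal_scope.

Lemma measurable_integral_kernel (k : R.-sfker X ~> Y) (f : Y -> \bar R) :
  measurable_fun setT f -> (forall y, 0 <= f y) ->
  measurable_fun setT (fun x => \int[k x]_y f y).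
Proof.
move=> mf f0; apply: measurable_fun_integral_kernel => //.
by move=> U mU; exact: measurable_kernel.
Qed.

Lemma daniell_kernel (L : (X -> \bar R) -> \bar R) (k : R.-sfker X ~> Y) :
  daniell L -> daniell (fun f => L (fun x => \int[k x]_y f y)).
Proof.
move=> [D Z M]; split.
- move=> f g mf mg f0 g0; rewrite -D//; last 4 first.
  + exact: measurable_integral_kernel.
  + exact: measurable_integral_kernel.
  + by move=> x; exact: integral_ge0.
  + by move=> x; exact: integral_ge0.
  by congr L; apply/funext => x /=; rewrite ge0_integralD.
- move=> c f c0 mf f0; rewrite -Z//.
  + by congr L; apply/funext => x /=; rewrite ge0_integralZl_EFin.
  + exact: measurable_integral_kernel.
  + by move=> x; exact: integral_ge0.
- move=> f_ f mf f0 nd cf.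
  apply: (M (fun n x => \int[k x]_y f_ n y)) => //.
  + by move=> n; apply: measurable_integral_kernel.
  + by move=> n x; apply: integral_ge0.
  + by move=> x a b ab; apply: ge0_le_integral => // y _; exact: nd.
  + move=> x; have [_ _] := daniell_integral (k x); exact.
Qed.

Lemma daniell_comp (L : (X -> \bar R) -> \bar R) (h : X -> Y) :
  measurable_fun setT h -> daniell L -> daniell (fun f => L (f \o h)).
Proof.
move=> mh [D Z M]; split.
- move=> f g mf mg f0 g0; rewrite -D//=.
  + exact: measurableT_comp.
  + exact: measurableT_comp.
- move=> c f c0 mf f0; rewrite -Z//=; exact: measurableT_comp.
- move=> f_ f mf f0 nd cf.
  apply: (M (fun n => f_ n \o h)) => //=.
  + by move=> n; apply: measurableT_comp.
Qed.

End daniell_kernel.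

(** * Bounded measurable functions and conditional laws *)

Section bounded_measurable.
Context d (T : measurableType d) (R : realType).
Implicit Types f g : T -> R.

(** Under a probability measure these functions form an algebra on which the real-valued integral is
    linear without further side conditions. *)
Definition bmeas f : Prop :=
  measurable_fun setT f /\ exists M, forall x, `|f x| <= M.

Lemma bmeas_measurable f : bmeas f -> measurable_fun setT f.
Proof. by case. Qed.

Lemma bmeas_cst (r : R) : bmeas (fun=> r).
Proof. by split => //; exists `|r|. Qed.

Lemma bmeasD f g : bmeas f -> bmeas g -> bmeas (fun x => f x + g x).
Proof.
move=> [mf [M fM]] [mg [N gN]]; split; first exact: measurable_funD.
by exists (M + N) => x; rewrite (le_trans (ler_normD _ _))// lerD.
Qed.

Lemma bmeasM f g : bmeas f -> bmeas g -> bmeas (fun x => f x * g x).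
Proof.
move=> [mf [M fM]] [mg [N gN]]; split; first exact: measurable_funM.
by exists (M * N) => x; rewrite normrM ler_pM.
Qed.

Lemma bmeasZ (r : R) f : bmeas f -> bmeas (fun x => r * f x).
Proof. by apply: bmeasM; exact: bmeas_cst. Qed.

Lemma bmeasB f g : bmeas f -> bmeas g -> bmeas (fun x => f x - g x).
Proof.
move=> mf mg; under eq_fun do rewrite -mulN1r.
by apply: bmeasD => //; exact: bmeasZ.
Qed.

Lemma bmeasX2 f : bmeas f -> bmeas (fun x => f x ^+ 2).
Proof. by move=> mf; under eq_fun do rewrite expr2; exact: bmeasM. Qed.

Lemma bmeas_sum (I : Type) (s : seq I) (F : I -> T -> R) :
  (forall i, bmeas (F i)) -> bmeas (fun x => \sum_(i <- s) F i x).
Proof.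
move=> mF; elim: s => [|i s IH].
  by under eq_fun do rewrite big_nil; exact: bmeas_cst.
by under eq_fun do rewrite big_cons; exact: bmeasD.
Qed.

(* Every bounded function is a difference of nonnegative ones. *)
Lemma bmeas_linear_ext (L1 L2 : (T -> R) -> R) :
  (forall f g, bmeas f -> bmeas g -> L1 (fun x => f x - g x) = L1 f - L1 g) ->
  (forall f g, bmeas f -> bmeas g -> L2 (fun x => f x - g x) = L2 f - L2 g) ->
  (forall f, bmeas f -> (forall x, 0 <= f x) -> L1 f = L2 f) ->
  forall f, bmeas f -> L1 f = L2 f.
Proof.
move=> B1 B2 L12 f bf; have [_ [M fM]] := bf.
have -> : f = fun x => (f x + `|M|) - `|M| by apply/funext => x; rewrite addrK.
have bM : bmeas (fun _ : T => `|M|) by exact: bmeas_cst.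
have bfM := bmeasD bf bM.
rewrite B1// B2//; congr (_ - _); apply: L12 => // x.
by have := ler_norm M; have := fM x; rewrite ler_norml => /andP[]; lra.
Qed.

Section Rint.
Variable mu : {measure set T -> \bar R}.
Hypothesis mu1 : mu setT = 1%E.

Lemma bmeas_integrable f : bmeas f -> mu.-integrable setT (EFin \o f).
Proof.
move=> [mf [M fM]]; apply: measurable_bounded_integrable => //.
  by rewrite mu1 ltry.
by exists M; split; [rewrite num_real|move=> x Mx y _; exact: le_trans (fM y) (ltW Mx)].
Qed.

Lemma bmeas_EFin f : bmeas f -> (\int[mu]_x (f x)%:E = (\int[mu]_x f x)%:E)%E.
Proof.
move=> bf; rewrite /Rintegral fineK//.
by apply: integrable_fin_num => //; exact: bmeas_integrable.
Qed.

Lemma bRintD f g : bmeas f -> bmeas g ->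
  \int[mu]_x (f x + g x) = \int[mu]_x f x + \int[mu]_x g x.
Proof. by move=> bf bg; rewrite RintegralD//; exact: bmeas_integrable. Qed.

Lemma bRintB f g : bmeas f -> bmeas g ->
  \int[mu]_x (f x - g x) = \int[mu]_x f x - \int[mu]_x g x.
Proof. by move=> bf bg; rewrite RintegralB//; exact: bmeas_integrable. Qed.

Lemma bRintZ r f : bmeas f -> \int[mu]_x (r * f x) = r * \int[mu]_x f x.
Proof. by move=> bf; rewrite RintegralZl//; exact: bmeas_integrable. Qed.

Lemma bRint_cst r : \int[mu]_x r = r.
Proof. by rewrite Rintegral_cst// mu1 mulr1. Qed.

Lemma bRint_le f g : bmeas f -> bmeas g -> (forall x, f x <= g x) ->
  \int[mu]_x f x <= \int[mu]_x g x.
Proof. by move=> bf bg fg; apply: le_Rintegral => //; exact: bmeas_integrable. Qed.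

Lemma bRint_norm f M : bmeas f -> (forall x, `|f x| <= M) ->
  `|\int[mu]_x f x| <= M.
Proof.
move=> bf fM; rewrite ler_norml -(bRint_cst (- M)) -{2}(bRint_cst M).
apply/andP; split; apply: bRint_le => //; try exact: bmeas_cst.
- by move=> x; have := fM x; rewrite ler_norml => /andP[].
- by move=> x; have := fM x; rewrite ler_norml => /andP[].
Qed.

Lemma bRint_sqrD f (t : R) : bmeas f ->
  \int[mu]_x ((f x - t) ^+ 2) =
  \int[mu]_x (f x ^+ 2) - t * \int[mu]_x f x *+ 2 + t ^+ 2.
Proof.
move=> bf.
have -> : (fun x => (f x - t) ^+ 2) = (fun x => f x ^+ 2 - (t *+ 2) * f x + t ^+ 2).
  by apply/funext => x; ring.
rewrite bRintD ?bRint_cst//; last 2 first.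
- by apply: bmeasB; [exact: bmeasX2|exact: bmeasZ].
- exact: bmeas_cst.
rewrite bRintB ?bRintZ//; [by ring|exact: bmeasX2|exact: bmeasZ].
Qed.

End Rint.
End bounded_measurable.

Section bounded_kernel.
Context d d' (X : measurableType d) (Y : measurableType d') (R : realType).
Variable k : R.-pker X ~> Y.

Lemma bmeas_kernel (f : Y -> R) : bmeas f -> bmeas (fun x => \int[k x]_y f y).
Proof.
move=> bf; have [mf [M fM]] := bf; split; last first.
  exists M => x; apply: bRint_norm => //; exact: prob_kernel.
(* [measurable_integral_kernel] concerns nonnegative integrands: [f] is shifted by [|M|], and the
   shift is subtracted again since [k x] has mass 1. *)
have -> : (fun x => \int[k x]_y f y) =
  fun x => fine (\int[k x]_y (f y + `|M|)%:E)%E - `|M|.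
  apply/funext => x; transitivity (\int[k x]_y (f y + `|M|) - `|M|) => //.
  have k1 : k x setT = 1%E by exact: prob_kernel.
  by rewrite bRintD// ?bRint_cst ?addrK//; exact: bmeas_cst.
apply: measurable_funB => //; apply: measurableT_comp => //.
apply: measurable_integral_kernel.
  by apply/measurable_EFinP; exact: measurable_funD.
move=> y; rewrite lee_fin.
by have := ler_norm M; have := fM y; rewrite ler_norml => /andP[]; lra.
Qed.

Lemma bmeas_kernel_ge0 (f : Y -> R) x : (forall y, 0 <= f y) ->
  0 <= \int[k x]_y f y.
Proof. by move=> f0; exact: Rintegral_ge0. Qed.

End bounded_kernel.

(** * Disintegration of the joint law and composed kernels *)

Section conditional_law.
Context d d' (X : measurableType d) (Y : measurableType d') (R : realType).
Variables (p : probability X R) (Q : R.-pker X ~> Y) (K : R.-pker Y ~> X).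
Hypothesis pQK : is_conditional_law p Q K.
Local Open Scope ereal_scope.

(** First extension from rectangles, in the variable of [X]: both sides are Daniell functionals of
    [F], and [F = \1_A] is the definition of the conditional law. *)
Lemma conditional_law_integral0 (B : set Y) (F : X -> \bar R) : measurable B ->
  measurable_fun setT F -> (forall x, 0 <= F x) ->
  \int[p]_x (Q x B * F x) =
  \int[p]_x \int[Q x]_y ((\1_B y)%:E * \int[K y]_z F z).
Proof.
move=> mB mF F0.
apply: (@daniell_eq _ _ _ (fun F => \int[p]_x (Q x B * F x))
  (fun F => \int[p]_x \int[Q x]_y ((\1_B y)%:E * \int[K y]_z F z))) => //.
- apply: (@daniell_mul _ _ _ (fun F => \int[p]_x F x)) => //.
  + exact: daniell_integral.
  + exact: measurable_kernel.
  + move=> x; rewrite ge0_fin_numE// (le_lt_trans _ (ltry 1))//.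
    rewrite -(@prob_kernel _ _ _ _ _ Q x); by apply: le_measure => //; exact/mem_set.
- apply: (@daniell_kernel _ _ _ _ _ (fun G => \int[p]_x \int[Q x]_y ((\1_B y)%:E * G y)) K).
  apply: (@daniell_mul _ _ _ (fun G => \int[p]_x \int[Q x]_y G y)) => //.
  + apply: (@daniell_kernel _ _ _ _ _ (fun G => \int[p]_x G x) Q).
    exact: daniell_integral.
  + by apply/measurable_EFinP; exact: measurable_indic.
- move=> A mA.
  transitivity (\int[p]_(x in A) Q x B).
    by rewrite [RHS]integral_mkcond; apply: eq_integral => x _;
      rewrite patchE indicE; case: (x \in A); rewrite ?mule1 ?mule0.
  rewrite (pQK mA mB); apply: eq_integral => x _.
  rewrite integral_mkcond; apply: eq_integral => y _.
  by rewrite patchE indicE; case: (y \in B); rewrite ?mul1e ?mul0e// integral_indic// setIT.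
Qed.

(** Second extension, in the variable of [Y]. Boundedness of [F] makes its integral against [K y] a
    finite factor, as [daniell_mul] requires. *)
Lemma conditional_law_integral1 (F : X -> R) (G : Y -> R) :
  bmeas F -> (forall x, 0 <= F x)%R ->
  measurable_fun setT G -> (forall y, 0 <= G y)%R ->
  \int[p]_x ((F x)%:E * \int[Q x]_y (G y)%:E) =
  \int[p]_x \int[Q x]_y ((\int[K y]_z F z)%R%:E * (G y)%:E).
Proof.
move=> bF F0 mG G0; have mF := bmeas_measurable bF.
apply: (@daniell_eq _ _ _ (fun G => \int[p]_x ((F x)%:E * \int[Q x]_y G y))
  (fun G => \int[p]_x \int[Q x]_y ((\int[K y]_z F z)%R%:E * G y))) => //.
- apply: (@daniell_kernel _ _ _ _ _ (fun G => \int[p]_x ((F x)%:E * G x)) Q).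
  apply: (@daniell_mul _ _ _ (fun F => \int[p]_x F x)) => //.
  + exact: daniell_integral.
  + exact/measurable_EFinP.
- apply: (@daniell_mul _ _ _ (fun G => \int[p]_x \int[Q x]_y G y)) => //.
  + apply: (@daniell_kernel _ _ _ _ _ (fun G => \int[p]_x G x) Q).
    exact: daniell_integral.
  + by apply/measurable_EFinP; exact: (bmeas_measurable (bmeas_kernel K bF)).
  + by move=> y; rewrite lee_fin; exact: bmeas_kernel_ge0.
- move=> B mB.
  under eq_integral do rewrite integral_indic// setIT muleC.
  have F0' x : 0 <= (F x)%:E by rewrite lee_fin.
  rewrite (conditional_law_integral0 mB (measurableT_comp _ mF) F0')//.
  apply: eq_integral => x _; apply: eq_integral => y _.
  by rewrite muleC bmeas_EFin//; exact: prob_kernel.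
- exact/measurable_EFinP.
Qed.

Local Open Scope ring_scope.

(** [Q] and [K] are adjoint between L^2 of [p] and L^2 of the law of Y. Taking for [G] the function
    [K F] turns <F, P F> into the second moment of [K F]. *)
Lemma conditional_law_Rintegral (F : X -> R) (G : Y -> R) : bmeas F -> bmeas G ->
  \int[p]_x (F x * \int[Q x]_y G y) =
  \int[p]_x \int[Q x]_y (\int[K y]_z F z * G y).
Proof.
have p1 : p setT = 1%E by exact: probability_setT.
have Q1 x : Q x setT = 1%E by exact: prob_kernel.
have K1 y : K y setT = 1%E by exact: prob_kernel.
move=> bF bG; move: F bF.
apply: (@bmeas_linear_ext _ _ _ (fun F => \int[p]_x (F x * \int[Q x]_y G y))
  (fun F => \int[p]_x \int[Q x]_y (\int[K y]_z F z * G y))).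
- move=> f g bf bg; rewrite -bRintB//; try exact: bmeasM (bmeas_kernel _ _).
  by apply: eq_Rintegral => x _; rewrite mulrBl.
- move=> f g bf bg.
  have bfG := bmeasM (bmeas_kernel K bf) bG.
  have bgG := bmeasM (bmeas_kernel K bg) bG.
  rewrite -bRintB//; try exact: bmeas_kernel.
  apply: eq_Rintegral => x _; rewrite -bRintB//.
  by apply: eq_Rintegral => y _; rewrite bRintB// mulrBl.
move=> F bF F0; move: G bG.
have bK := bmeas_kernel K bF.
apply: (@bmeas_linear_ext _ _ _ (fun G => \int[p]_x (F x * \int[Q x]_y G y))
  (fun G => \int[p]_x \int[Q x]_y (\int[K y]_z F z * G y))).
- move=> f g bf bg.
  have bfF := bmeasM bF (bmeas_kernel Q bf).
  have bgF := bmeasM bF (bmeas_kernel Q bg).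
  rewrite -bRintB//; apply: eq_Rintegral => x _.
  by rewrite bRintB ?mulrBr//; exact: Q1.
- move=> f g bf bg.
  have bfK := bmeasM bK bf; have bgK := bmeasM bK bg.
  rewrite -bRintB//; try exact: bmeas_kernel.
  apply: eq_Rintegral => x _; rewrite -bRintB//.
  by apply: eq_Rintegral => y _; rewrite mulrBr.
move=> G bG G0; congr fine.
have := conditional_law_integral1 bF F0 (bmeas_measurable bG) G0.
have -> : (\int[p]_x ((F x)%:E * \int[Q x]_y (G y)%:E) =
   \int[p]_x (F x * \int[Q x]_y G y)%:E)%E.
  by apply: eq_integral => x _; rewrite EFinM (bmeas_EFin (Q1 x)).
move=> ->; apply: eq_integral => x _; rewrite -(bmeas_EFin (Q1 x))//.
exact: bmeasM.
Qed.

(** Adjointness with [G = 1]: the law [p] is stationary for the composed chain. *)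
Lemma conditional_law_Rintegral_kernel (F : X -> R) : bmeas F ->
  \int[p]_x \int[Q x]_y \int[K y]_z F z = \int[p]_x F x.
Proof.
move=> bF; have := conditional_law_Rintegral bF (bmeas_cst _ 1).
have Q1 x : Q x setT = 1%E by exact: prob_kernel.
under eq_Rintegral do rewrite bRint_cst// mulr1.
by move=> ->; apply: eq_Rintegral => x _; apply: eq_Rintegral => y _; rewrite mulr1.
Qed.

End conditional_law.

Section kernel_composition.
Context d d' (X : measurableType d) (Y : measurableType d') (R : realType).
Variables (Q : R.-pker X ~> Y) (K : R.-pker Y ~> X).
Let P := mkcomp_noparam Q K.

Lemma ge0_integral_mkcomp_noparam x (f : X -> \bar R) :
  measurable_fun setT f -> (forall z, 0 <= f z)%E ->
  (\int[P x]_z f z = \int[Q x]_y \int[K y]_z f z)%E.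
Proof.
move=> mf f0.
apply: (@daniell_eq _ _ _ (fun f => \int[P x]_z f z)%E
  (fun f => \int[Q x]_y \int[K y]_z f z)%E) => //.
- exact: daniell_integral.
- apply: (@daniell_kernel _ _ _ _ _ (fun f => \int[Q x]_y f y)%E K).
  exact: daniell_integral.
- move=> A mA; rewrite integral_indic// setIT.
  by apply: eq_integral => y _; rewrite integral_indic// setIT.
Qed.

Lemma mkcomp_noparam_setT x : P x setT = 1%E.
Proof.
rewrite /P /mkcomp_noparam/= /kcomp_noparam.
under eq_integral do rewrite prob_kernel.
by rewrite integral_cst// mul1e prob_kernel.
Qed.

Lemma Rintegral_mkcomp_noparam x (f : X -> R) : bmeas f ->
  \int[P x]_z f z = \int[Q x]_y \int[K y]_z f z.
Proof.
have P1 := mkcomp_noparam_setT x.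
have Q1 : Q x setT = 1%E by exact: prob_kernel.
have K1 y : K y setT = 1%E by exact: prob_kernel.
apply: (@bmeas_linear_ext _ _ _ (fun f => \int[P x]_z f z)
  (fun f => \int[Q x]_y \int[K y]_z f z)).
- by move=> u v bu bv; rewrite bRintB.
- move=> u v bu bv; rewrite -bRintB//; try exact: bmeas_kernel.
  by apply: eq_Rintegral => y _; rewrite bRintB.
move=> g bg g0; congr fine.
rewrite ge0_integral_mkcomp_noparam//.
- by apply: eq_integral => y _; rewrite bmeas_EFin.
- by apply/measurable_EFinP; case: bg.
Qed.

End kernel_composition.

(** * Smoothness from bounded partial derivatives *)

Section bounded_partials.
Context {R : realType} (n : nat).
Implicit Types (f : 'rV[R]_n -> R) (x y : 'rV[R]_n).

Let e (i : 'I_n) : 'rV[R]_n := delta_mx ord0 i.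

(** Equality of difference quotients, through which partial derivatives are treated as derivatives
    of one-variable functions. *)
Let quotient_line f (i : 'I_n) x (t : R) :
  (fun h : R => h^-1 *: (((fun t : R => f (t *: e i + x)) \o shift t) (h *: 1) -
     f (t *: e i + x))) =
  (fun h : R => h^-1 *: ((f \o shift (t *: e i + x)) (h *: e i) - f (t *: e i + x))).
Proof.
apply/funext => h /=; congr (_ *: (f _ - _)).
by rewrite addrA -scalerDl [h *: 1]mulr1.
Qed.

Lemma is_derive_line f (i : 'I_n) x (t : R) :
  derivable f (t *: e i + x) (e i) ->
  is_derive t 1 (fun t : R => f (t *: e i + x)) (partial i f (t *: e i + x)).
Proof.
move=> df; apply: DeriveDef.
- by move: df; rewrite /derivable quotient_line.
- by rewrite /partial /derive quotient_line.
Qed.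

Lemma derivable_lineP f (i : 'I_n) x (t : R) :
  derivable (fun t : R => f (t *: e i + x)) t 1 ->
  derivable f (t *: e i + x) (e i).
Proof. by rewrite /derivable quotient_line. Qed.

Lemma partial_lineE f (i : 'I_n) x (t : R) :
  partial i f (t *: e i + x) = 'D_1 (fun t : R => f (t *: e i + x)) t.
Proof. by rewrite /partial /derive quotient_line. Qed.

Lemma bounded_partial_lipschitz f (i : 'I_n) (L : R) x (t : R) :
  (forall x, derivable f x (e i)) -> (forall x, `|partial i f x| <= L) ->
  `|f (t *: e i + x) - f x| <= L * `|t|.
Proof.
move=> df fL; pose g (t : R) := f (t *: e i + x).
have dg (t' : R) : is_derive t' (1 : R) g (partial i f (t' *: e i + x)) by exact: is_derive_line.
have cg : continuous g.
  by move=> t'; apply/differentiable_continuous/derivable1_diffP; case: (dg t').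
have g0 : f x = g 0 by rewrite /g scale0r add0r.
rewrite g0 -/(g t).
have [t0|t0|<-] := ltgtP 0 t.
- have [c _ ->] := MVT_segment (ltW t0) (fun u _ => dg u) (continuous_subspaceT cg).
  by rewrite subr0 normrM ler_wpM2r.
- have [c _ h] := MVT_segment (ltW t0) (fun u _ => dg u) (continuous_subspaceT cg).
  by rewrite distrC h sub0r normrM normrN ler_wpM2r.
- by rewrite subrr !normr0 mulr0.
Qed.

(** Bounded partials make [f] Lipschitz along each axis; moving from one point to another one
    coordinate at a time adds up these bounds. *)
Lemma bounded_partials_continuous f (L : R) :
  (forall i x, derivable f x (e i)) -> (forall i x, `|partial i f x| <= L) ->
  continuous f.
Proof.
move=> df fL x.
(* The broken path from [x] to [y]: the point [z m] already has the first [m] coordinates of [y]. *)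
have lip y : `|f y - f x| <= \sum_(i < n) `|L| * `|y ord0 i - x ord0 i|.
  pose z (m : nat) : 'rV[R]_n := \row_i (if (i < m)%N then y ord0 i else x ord0 i).
  have -> : f x = f (z 0%N) by congr f; apply/rowP => i; rewrite mxE.
  have -> : f y = f (z n) by congr f; apply/rowP => i; rewrite mxE ltn_ord.
  rewrite -(@telescope_sumr _ 0 n (fun m => f (z m)))// big_mkord.
  apply: (le_trans (ler_norm_sum _ _ _)); apply: ler_sum => i _.
  have -> : z i.+1 = (y ord0 i - x ord0 i) *: e i + z i.
    apply/rowP => j; rewrite !mxE eqxx/= ltnS leq_eqVlt.
    have [->|ji] := eqVneq j i; first by rewrite eqxx/= mulr1 ltnn subrK.
    by rewrite (_ : (j == i :> nat) = false) ?mulr0 ?add0r//; exact: negbTE.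
  apply: bounded_partial_lipschitz => // y'; exact: le_trans (fL _ _) (ler_norm _).
apply/(@cvgrPdist_lt _ R _ (nbhs x) (nbhs_filter x)) => eps eps0.
pose S := \sum_(i < n) `|L|.
have S0 : 0 <= S by exact: sumr_ge0.
(* The ball is for the sup norm, so one radius controls all coordinates; [S + 1] avoids dividing by
   a vanishing [S]. *)
apply/nbhs_ballP; exists (eps / (S + 1)) => /=; first by rewrite divr_gt0// ltr_wpDl.
move=> y xy; rewrite distrC (le_lt_trans (lip y))//.
apply: (@le_lt_trans _ _ (S * (eps / (S + 1)))).
  rewrite mulr_suml; apply: ler_sum => i _; rewrite ler_wpM2l//.
  by case: xy => _ /(_ ord0 i) /ltW; rewrite distrC.
rewrite mulrCA gtr_pMr// ltr_pdivrMr ?mul1r ?ltrDl//.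
by rewrite ltr_wpDl.
Qed.

(** All iterated partials stay in [F], and a member is continuous because its own partials, being
    members, are bounded. Continuity therefore never has to be proved separately. *)
Lemma smooth_bounded_family (F : ('rV[R]_n -> R) -> Prop) :
  (forall f, F f -> exists M, forall x, `|f x| <= M) ->
  (forall f, F f -> forall i x, derivable f x (e i)) ->
  (forall f i, F f -> F (partial i f)) ->
  forall f, F f -> smooth f.
Proof.
move=> Fb Fd Fp f Ff.
have Fs s : F (partials s f) by elim: s => //= i s IH; exact: Fp.
have cF g : F g -> continuous g.
  move=> Fg; have /choice[M hM] : forall i, exists M, forall x, `|partial i g x| <= M.
    by move=> i; exact/Fb/Fp.
  apply: (@bounded_partials_continuous g (\sum_i `|M i|)) => [|i x]; first exact: Fd.
  rewrite (le_trans (hM i x))// (le_trans (ler_norm _))//.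
  by rewrite (bigD1 i)//= lerDl sumr_ge0.
move=> k; split => s _; first exact: cF.
by move=> i x; exact: Fd.
Qed.

End bounded_partials.

(** * Gaussian convolutions *)

Section polynomial_gaussian.
Context {R : realType}.
Implicit Types (p : {poly R}) (c u v r : R).

(** Induction on the polynomial with [c] free: half of the exponent serves the induction hypothesis,
    the other half absorbs the extra factor [v]. *)
Lemma horner_le_expR p c : 0 < c ->
  exists A, 0 <= A /\ forall v, `|p.[v]| <= A * expR (c * v ^+ 2).
Proof.
move: c; elim/poly_ind: p => [|p b IH] c c0.
  by exists 0; split => // v; rewrite horner0 normr0 mul0r.
have [|A [A0 hA]] := IH (c / 2); first by rewrite divr_gt0.
(* With t = c v^2 / 2 one has |v| <= 1 + v^2 = 1 + (2 / c) t <= (1 + 2 / c) e^t. *)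
exists (A * (1 + 2 / c) + `|b|); split.
  by rewrite addr_ge0// mulr_ge0// addr_ge0// divr_ge0// ltW.
move=> v; rewrite hornerD hornerMX hornerC (le_trans (ler_normD _ _))// mulrDl lerD//.
  have -> : c * v ^+ 2 = c / 2 * v ^+ 2 + c / 2 * v ^+ 2 by field.
  rewrite expRD normrM; set t := c / 2 * v ^+ 2.
  rewrite (_ : A * (1 + 2 / c) * (expR t * expR t) =
    (A * expR t) * ((1 + 2 / c) * expR t)); last by ring.
  rewrite ler_pM//.
  have t1 : 1 + t <= expR t by exact: expR_ge1Dx.
  have t0 : 0 <= t by rewrite mulr_ge0 ?sqr_ge0// divr_ge0// ltW.
  have v1 : `|v| <= 1 + v ^+ 2 by rewrite ler_norml; apply/andP; split; nra.
  apply: (le_trans v1).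
  have -> : 1 + v ^+ 2 = 1 + 2 / c * t by rewrite /t; field; rewrite gt_eqF.
  have c2 : 0 <= 2 / c by rewrite divr_ge0// ltW.
  have e1 : 1 <= expR t by lra.
  by rewrite [leRHS]mulrDl mul1r; apply: lerD => //; apply: ler_wpM2l => //; lra.
rewrite ler_peMr// -expR0 ler_expR mulr_ge0 ?sqr_ge0//; exact: ltW.
Qed.

Variable s : R.
Hypothesis s0 : 0 < s.

Definition polygauss p u : R := p.[u] * normal_pdf 0 s u.

Lemma normal_pdf0E t u : t != 0 ->
  normal_pdf 0 t u = normal_peak t * expR (- u ^+ 2 / (t ^+ 2 *+ 2)).
Proof. by move=> t0; rewrite normal_pdfE// /normal_fun subr0. Qed.

(** A bound uniform over bounded translations, needed to differentiate under the integral sign;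
    widening the Gaussian pays for both the polynomial and the translation. *)
Lemma polygauss_dominated p r : 0 <= r -> exists A, 0 <= A /\
  forall u v, `|v| <= r -> `|polygauss p (u - v)| <= A * normal_pdf 0 (2 * s) u.
Proof.
move=> r0; have sn0 : s != 0 by rewrite gt_eqF.
(* Half of the Gaussian rate 1 / (2 s^2) is spent on the polynomial; half of what remains is spent
   on the translation, which leaves 1 / (8 s^2), the rate of standard deviation 2 s. *)
have c0 : 0 < (s ^+ 2 *+ 4)^-1 by rewrite invr_gt0 mulrn_wgt0// exprn_gt0.
have [A [A0 hA]] := horner_le_expR p c0.
have s20 : 2 * s != 0 by rewrite mulf_neq0.
have pk := normal_peak_gt0 sn0; have pk2 := normal_peak_gt0 s20.
exists (A * normal_peak s / normal_peak (2 * s) * expR (r ^+ 2 / (s ^+ 2 *+ 4))).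
split.
  by rewrite mulr_ge0 ?expR_ge0// divr_ge0 ?normal_peak_ge0// mulr_ge0// normal_peak_ge0.
move=> u v vr; rewrite /polygauss !normal_pdf0E// normrM.
rewrite (ger0_norm (mulr_ge0 (normal_peak_ge0 _) (expR_ge0 _))).
apply: (le_trans (ler_wpM2r (mulr_ge0 (normal_peak_ge0 _) (expR_ge0 _)) (hA _))).
have -> : forall (B C : R), A * normal_peak s / normal_peak (2 * s) * B * (normal_peak (2 * s) * C) = A * normal_peak s * (B * C).
  by move=> B C; field; rewrite gt_eqF.
rewrite mulrACA -!expRD ler_wpM2l ?mulr_ge0 ?normal_peak_ge0// ler_expR.
have v2 : v ^+ 2 <= r ^+ 2 by rewrite -(real_normK (num_real v)) lerXn2r ?nnegrE.
have -> : (s ^+ 2 *+ 4)^-1 * (u - v) ^+ 2 + - (u - v) ^+ 2 / (s ^+ 2 *+ 2) =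
   - ((u - v) ^+ 2 *+ 2) / (s ^+ 2 *+ 8) by field; rewrite sn0.
have -> : r ^+ 2 / (s ^+ 2 *+ 4) + - u ^+ 2 / ((2 * s) ^+ 2 *+ 2) =
   (r ^+ 2 *+ 2 - u ^+ 2) / (s ^+ 2 *+ 8) by field; rewrite sn0.
rewrite ler_wpM2r ?invr_ge0 ?mulrn_wge0 ?sqr_ge0//.
(* Equivalent to u^2 <= 2 (u - v)^2 + 2 v^2. *)
have : 0 <= (u - 2 * v) ^+ 2 by exact: sqr_ge0.
by nra.
Qed.

(** The centred Gaussian density satisfies phi' = - s^-2 u phi, so this is the polynomial factor of
    (p phi)'. *)
Definition polygauss_deriv p : {poly R} := p^`() - s^-2 *: ('X * p).

Lemma is_derive_polygauss p (u : R) :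
  is_derive u (1 : R) (polygauss p) (polygauss (polygauss_deriv p) u).
Proof.
have sn0 : s != 0 by rewrite gt_eqF.
have -> : polygauss p = fun u => p.[u] * (normal_peak s * expR (- (s ^+ 2 *+ 2)^-1 * u ^+ 2)).
  apply/funext => v; rewrite /polygauss normal_pdf0E//; congr (_ * (_ * expR _)).
  by rewrite mulNr mulrC mulNr.
have dp : is_derive u (1 : R) (horner p) (p^`()).[u] by exact: is_derive_poly.
apply: is_derive_eq.
rewrite /polygauss normal_pdf0E// /polygauss_deriv !hornerE /=.
rewrite [X in expR X](_ : _ = - u ^+ 2 / (s ^+ 2 *+ 2)); last first.
  by field.
rewrite /GRing.scale/= !mulr1.
by field.
Qed.

End polynomial_gaussian.

Lemma integrable_normal_rV_pdf {R : realType} n (m : 'rV[R]_n) s :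
  (lebesgue_rV n).-integrable setT (EFin \o normal_rV_pdf m s).
Proof.
apply/integrableP; split.
  by apply/measurable_EFinP; exact: measurable_normal_rV_pdf.
under eq_integral do rewrite /= ger0_norm ?normal_rV_pdf_ge0//.
by rewrite integral_normal_rV_pdf ltry.
Qed.

Lemma integrable_scale_normal_rV_pdf {R : realType} n (A : R) (m : 'rV[R]_n) s :
  (lebesgue_rV n).-integrable setT (EFin \o (fun y => A * normal_rV_pdf m s y)).
Proof. exact: (integrableZl measurableT A (integrable_normal_rV_pdf m s)). Qed.

Section gaussian_convolution.
Context {R : realType} (n : nat) (a s : R).
Hypothesis s0 : 0 < s.
Implicit Types (p : 'I_n -> {poly R}) (x y : 'rV[R]_n) (g : 'rV[R]_n -> R).

(** One polynomial per coordinate: a partial derivative in [x] then changes a single factor and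
    stays in the family. *)
Definition gker p x y : R := \prod_(i < n) polygauss s (p i) (y ord0 i - a * x ord0 i).

Lemma gker1 x y : gker (fun=> 1) x y = normal_rV_pdf (a *: x) s y.
Proof.
apply: eq_bigr => i _; rewrite /polygauss hornerC mul1r mxE.
have sn0 : s != 0 by rewrite gt_eqF.
by rewrite normal_pdf0E// normal_pdfE.
Qed.

Lemma measurable_gker p x : measurable_fun setT (gker p x).
Proof.
apply: measurable_prod => i _; apply: measurable_funM.
- apply: (measurableT_comp (f := horner (p i))).
    apply: continuous_measurable_fun => u.
    by apply/differentiable_continuous/derivable1_diffP; exact: derivable_horner.
  by apply: measurable_funB => //; exact: measurable_coord.
- apply: (measurableT_comp (measurable_normal_pdf 0 s)).
  by apply: measurable_funB => //; exact: measurable_coord.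
Qed.

Lemma gker_dominated p r : 0 <= r -> exists A, 0 <= A /\
  forall x x' y, (forall i, `|a * (x' ord0 i - x ord0 i)| <= r) ->
    `|gker p x' y| <= A * normal_rV_pdf (a *: x) (2 * s) y.
Proof.
move=> r0.
have /choice[A hA] : forall i, exists A, 0 <= A /\ forall u v, `|v| <= r ->
    `|polygauss s (p i) (u - v)| <= A * normal_pdf 0 (2 * s) u.
  by move=> i; exact: polygauss_dominated.
exists (\prod_i A i); split; first by apply: prodr_ge0 => i _; case: (hA i).
have sn0 : 2 * s != 0 by rewrite gt_eqF// mulr_gt0.
move=> x x' y xx'; rewrite /gker normr_prod /normal_rV_pdf -big_split/=.
apply: ler_prod => i _; rewrite normr_ge0/=.
have -> : y ord0 i - a * x' ord0 i =
    (y ord0 i - a * x ord0 i) - a * (x' ord0 i - x ord0 i) by ring.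
have [_ /(_ _ _ (xx' i)) /le_trans] := hA i; apply.
by rewrite normal_pdf0E// normal_pdfE// mxE.
Qed.

Section gconv.
Variable g : 'rV[R]_n -> R.
Hypothesis bg : bmeas g.

Definition gconv p x : R := \int[lebesgue_rV n]_y (g y * gker p x y).

Lemma measurable_gconv p x : measurable_fun setT (fun y => g y * gker p x y).
Proof.
by apply: measurable_funM; [exact: bmeas_measurable|exact: measurable_gker].
Qed.

(** [A] is independent of [x]. The case [r = 0] gives integrability and a uniform bound on [gconv];
    the case [r = |a|] dominates the derivatives along a segment. *)
Lemma gconv_dominated p r : 0 <= r -> exists A, 0 <= A /\
  forall x x' y, (forall i, `|a * (x' ord0 i - x ord0 i)| <= r) ->
    `|g y * gker p x' y| <= A * normal_rV_pdf (a *: x) (2 * s) y.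
Proof.
move=> r0; have [_ [M gM]] := bg; have [A [A0 hA]] := gker_dominated p r0.
exists (`|M| * A); split; first by rewrite mulr_ge0.
move=> x x' y xx'; rewrite normrM -mulrA ler_pM//; last exact: hA.
exact: le_trans (gM y) (ler_norm _).
Qed.

Lemma integrable_gconv p x :
  (lebesgue_rV n).-integrable setT (EFin \o (fun y => g y * gker p x y)).
Proof.
have [A [A0 hA]] := gconv_dominated p (lexx 0).
apply: (le_integrable measurableT (g := EFin \o (fun y => A * normal_rV_pdf (a *: x) (2 * s) y))).
- by apply/measurable_EFinP; exact: measurable_gconv.
- move=> y _ /=; rewrite lee_fin [leRHS]ger0_norm ?mulr_ge0 ?normal_rV_pdf_ge0//.
  by apply: hA => i; rewrite subrr mulr0 normr0.
- exact: integrable_scale_normal_rV_pdf.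
Qed.

Lemma gconv_bounded p : exists M, forall x, `|gconv p x| <= M.
Proof.
have [A [A0 hA]] := gconv_dominated p (lexx 0).
exists A => x; rewrite /gconv.
apply: (le_trans (le_normr_Rintegral measurableT (integrable_gconv p x))).
have -> : A = \int[lebesgue_rV n]_y (A * normal_rV_pdf (a *: x) (2 * s) y).
  rewrite RintegralZl//; last exact: integrable_normal_rV_pdf.
  by rewrite /Rintegral integral_normal_rV_pdf mulr1.
apply: le_Rintegral => //.
- exact/integrable_norm/integrable_gconv.
- exact: integrable_scale_normal_rV_pdf.
- by move=> y _; apply: hA => i; rewrite subrr mulr0 normr0.
Qed.

(** The factor [- a] is the chain rule for the argument [y_j - a x_j]. *)
Definition dpoly p (j : 'I_n) : 'I_n -> {poly R} :=
  fun i => if i == j then - a *: polygauss_deriv s (p j) else p i.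

Let e (i : 'I_n) : 'rV[R]_n := delta_mx ord0 i.

Lemma is_derive_gker p j x y (t : R) :
  is_derive t (1 : R) (fun t : R => gker p (t *: e j + x) y)
    (gker (dpoly p j) (t *: e j + x) y).
Proof.
pose c := \prod_(i < n | i != j) polygauss s (p i) (y ord0 i - a * x ord0 i).
have gE t' : gker p (t' *: e j + x) y =
    c * polygauss s (p j) (- a * t' + (y ord0 j - a * x ord0 j)).
  rewrite /gker (bigD1 j)//= mulrC; congr (_ * _).
    apply: eq_bigr => i ij; rewrite !mxE eqxx/= (negbTE ij) mulr0 add0r//.
  by congr polygauss; rewrite !mxE !eqxx/= mulr1; ring.
have -> : gker (dpoly p j) (t *: e j + x) y =
    c * (- a * polygauss s (polygauss_deriv s (p j)) (- a * t + (y ord0 j - a * x ord0 j))).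
  rewrite /gker (bigD1 j)//= mulrC; congr (_ * _).
    apply: eq_bigr => i ij; rewrite /dpoly (negbTE ij) !mxE eqxx/= (negbTE ij) mulr0 add0r//.
  rewrite /dpoly eqxx /polygauss hornerZ !mxE !eqxx/= mulr1 -mulrA.
  by rewrite (_ : y ord0 j - _ = - a * t + (y ord0 j - a * x ord0 j)); last by ring.
under eq_fun do rewrite gE.
have d1 : is_derive t (1 : R) (fun t : R => - a * t + (y ord0 j - a * x ord0 j)) (- a).
  by apply: is_derive_eq; rewrite /GRing.scale/= mulr1 addr0.
have d2 := is_derive_polygauss s0 (p j) (- a * t + (y ord0 j - a * x ord0 j)).
have d3 := @is_derive1_comp R (polygauss s (p j)) _ t _ _ d2 d1.
rewrite [- a * polygauss _ _ _]mulrC; exact: (is_deriveZ c d3).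
Qed.

Lemma gconv_derive p j x : derivable (gconv p) x (e j) /\
  partial j (gconv p) x = gconv (dpoly p j) x.
Proof.
pose f (t : R) y := g y * gker p (t *: e j + x) y.
have df (t : R) y : is_derive t (1 : R) (f ^~ y) (g y * gker (dpoly p j) (t *: e j + x) y).
  have := is_derive_gker p j x y t => h.
  by apply: is_derive_eq; rewrite /GRing.scale/=.
have pf t y : partial1of2 f t y = g y * gker (dpoly p j) (t *: e j + x) y.
  by rewrite partial1of2E; apply: derive_val.
(* For [t] in ]-1, 1[ the point [t *: e j + x] moves each argument by at most [|a|], so one
   dominating function serves the whole interval. *)
have [A [A0 hA]] := gconv_dominated (dpoly p j) (normr_ge0 a).
pose G y := A * normal_rV_pdf (a *: x) (2 * s) y.
have I0 : `](-1), 1[%classic (0 : R) by rewrite /= in_itv/=; lra.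
have fint (t : R) : `](-1), 1[%classic t -> (lebesgue_rV n).-integrable setT (EFin \o f t).
  by move=> _; exact: integrable_gconv.
have fder (t : R) (y : 'rV[R]_n) : `](-1), 1[%classic t -> [set: 'rV[R]_n] y -> derivable (f ^~ y) t 1.
  by move=> _ _; case: (df t y).
have G0 y : 0 <= G y by rewrite mulr_ge0// normal_rV_pdf_ge0.
have Gint : (lebesgue_rV n).-integrable setT (EFin \o G).
  exact: integrable_scale_normal_rV_pdf.
have fG (t : R) (y : 'rV[R]_n) : `](-1), 1[%classic t -> [set: 'rV[R]_n] y -> `|partial1of2 f t y| <= G y.
  rewrite /= in_itv/= => /andP[t1 t2] _; rewrite pf; apply: hA => i.
  rewrite !mxE addrK eqxx/= normrM ler_piMr// normrM.
  have t3 : `|t| <= 1 by rewrite ler_norml; apply/andP; split; exact: ltW.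
  by case: eqP => _; rewrite ?normr1 ?normr0 ?mulr1 ?mulr0.
have D1 := derivable_under_integral measurableT I0 fint fder G0 Gint fG.
have D2 := differentiation_under_integral measurableT I0 fint fder G0 Gint fG.
have xE : x = (0 : R) *: e j + x by rewrite scale0r add0r.
split.
  by rewrite xE; apply: derivable_lineP.
rewrite {1}xE partial_lineE -derive1E D2 /gconv.
by apply: eq_Rintegral => y _; rewrite pf scale0r add0r.
Qed.

Lemma smooth_gconv p : smooth (gconv p).
Proof.
apply: (@smooth_bounded_family R n (fun f => exists p, f = gconv p)); last by exists p.
- by move=> _ [q ->]; exact: gconv_bounded.
- by move=> _ [q ->] i x; case: (gconv_derive q i x).
- move=> _ i [q ->]; exists (dpoly q i); apply/funext => x.
  by case: (gconv_derive q i x).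
Qed.

End gconv.
End gaussian_convolution.

(** * Gaussian moments and the gradient bound *)

Section has_Rintegral.
Context d (T : measurableType d) (R : realType) (mu : {measure set T -> \bar R}).
Implicit Types (f g : T -> R) (u v : R).

(** Integrability and value travel together, so that a long linear combination is integrated term by
    term. *)
Definition has_Rintegral f v : Prop :=
  mu.-integrable setT (EFin \o f) /\ \int[mu]_x f x = v.

Lemma has_RintegralD f g u v : has_Rintegral f u -> has_Rintegral g v ->
  has_Rintegral (fun x => f x + g x) (u + v).
Proof.
move=> [fi <-] [gi <-]; split; last by rewrite RintegralD.
exact: (integrableD measurableT fi gi).
Qed.

Lemma has_RintegralZ (r : R) f v : has_Rintegral f v ->
  has_Rintegral (fun x => r * f x) (r * v).
Proof.
move=> [fi <-]; split; last by rewrite RintegralZl.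
exact: (integrableZl measurableT r fi).
Qed.

Lemma has_Rintegral_sum (I : finType) (F : I -> T -> R) (v : I -> R) :
  (forall i, has_Rintegral (F i) (v i)) ->
  has_Rintegral (fun x => \sum_i F i x) (\sum_i v i).
Proof.
move=> Fv.
elim: (index_enum I) => [|i r IH].
  under eq_fun do rewrite big_nil; rewrite big_nil; split.
    exact: integrable0.
  by rewrite /Rintegral integral0.
by under eq_fun do rewrite big_cons; rewrite big_cons; exact: has_RintegralD.
Qed.

End has_Rintegral.

Section normal_integral.
Context {R : realType} (n : nat).

Lemma ge0_integral_normal_rV (m : 'rV[R]_n) (s : R) (f : 'rV[R]_n -> \bar R) :
  measurable_fun setT f -> (forall y, 0 <= f y)%E ->
  (\int[normal_rV m s]_y f y =
   \int[lebesgue_rV n]_y ((normal_rV_pdf m s y)%:E * f y))%E.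
Proof.
move=> mf f0; apply: (@daniell_eq _ _ _ (fun f => \int[normal_rV m s]_y f y)%E
   (fun f => \int[lebesgue_rV n]_y ((normal_rV_pdf m s y)%:E * f y))%E) => //.
- exact: daniell_integral.
- apply: (@daniell_mul _ _ _ (fun f => \int[lebesgue_rV n]_y f y)%E) => //.
  + exact: daniell_integral.
  + by apply/measurable_EFinP; exact: measurable_normal_rV_pdf.
  + by move=> y; rewrite lee_fin normal_rV_pdf_ge0.
- move=> A mA; rewrite integral_indic// setIT.
  rewrite [LHS]integral_mkcond; apply: eq_integral => y _.
  by rewrite patchE indicE; case: (y \in A); rewrite ?mule1 ?mule0.
Qed.

Variables (a s : R).
Hypothesis s0 : 0 < s.

Lemma Rintegral_normal_kernel (g : 'rV[R]_n -> R) x : bmeas g ->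
  \int[normal_kernel a s x]_y g y = gconv a s g (fun=> 1) x.
Proof.
have N1 : normal_kernel a s x setT = 1%E by exact: integral_normal_rV_pdf.
apply: (@bmeas_linear_ext _ _ _ (fun g => \int[normal_kernel a s x]_y g y)
  (fun g => gconv a s g (fun=> 1) x)).
- by move=> f h bf bh; rewrite bRintB.
- move=> f h bf bh; rewrite /gconv -RintegralB//; try exact: integrable_gconv.
  by apply: eq_Rintegral => y _; rewrite mulrBl.
- move=> f bf f0; congr fine.
  rewrite ge0_integral_normal_rV//; last exact/measurable_EFinP/bmeas_measurable.
  by apply: eq_integral => y _; rewrite -EFinM gker1// mulrC.
Qed.

Lemma gconv_one x : gconv a s (fun=> 1) (fun _ : 'I_n => 1) x = 1.
Proof.
rewrite -Rintegral_normal_kernel; last exact: bmeas_cst.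
by rewrite bRint_cst//; exact: integral_normal_rV_pdf.
Qed.

(** With this factor [u x y j] is the score, the derivative in [x_j] of the logarithm of the
    Gaussian density. Under that Gaussian the scores are centred and uncorrelated with variance
    [(a / s) ^+ 2]. *)
Let b := a / s ^+ 2.
Let u (x y : 'rV[R]_n) (j : 'I_n) := b * (y ord0 j - a * x ord0 j).
Let p1 : 'I_n -> {poly R} := fun=> 1.

Let pd1 : - a *: polygauss_deriv s (1 : {poly R}) = b *: 'X.
Proof.
by rewrite /polygauss_deriv mulr1 -polyC1 derivC sub0r scalerN scaleNr opprK scalerA.
Qed.

Let pd2 v : (- a *: polygauss_deriv s (b *: 'X)).[v] = b ^+ 2 * v ^+ 2 - (a / s) ^+ 2.
Proof.
rewrite /polygauss_deriv derivZ derivX !(hornerZ, hornerD, hornerN, hornerM, hornerC, hornerX).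
by rewrite /b; field; rewrite gt_eqF.
Qed.

Lemma gker_dpoly1 j x y : gker a s (dpoly a s p1 j) x y = u x y j * gker a s p1 x y.
Proof.
rewrite /gker (bigD1 j)//= [in RHS](bigD1 j)//= mulrA; congr (_ * _).
  rewrite /dpoly eqxx pd1 /polygauss /u mulrA; congr (_ * _).
  by rewrite hornerC hornerZ hornerX mulr1.
by apply: eq_bigr => i ij; rewrite /dpoly (negbTE ij).
Qed.

(** A second Hermite polynomial when [j = k], a product of two first ones otherwise. Once the left
    side is known to integrate to 0, the covariances of the scores can be read off. *)
Lemma gker_dpoly2 j k x y : gker a s (dpoly a s (dpoly a s p1 j) k) x y =
  (u x y j * u x y k - (j == k)%:R * (a / s) ^+ 2) * gker a s p1 x y.
Proof.
rewrite /gker (bigD1 k)//= [in RHS](bigD1 k)//=.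
have [->|jk] := eqVneq j k.
  rewrite mulrA; congr (_ * _).
    rewrite /dpoly !eqxx pd1 /polygauss pd2 /u mulrA; congr (_ * _).
      by rewrite mul1r; ring.
    by rewrite hornerC mul1r.
  by apply: eq_bigr => i ij; rewrite /dpoly (negbTE ij).
rewrite (bigD1 j)//= [in RHS](bigD1 j)//= mul0r subr0.
rewrite (_ : u x y j * u x y k *
   (polygauss s (p1 k) (y ord0 k - a * x ord0 k) *
   (polygauss s (p1 j) (y ord0 j - a * x ord0 j) *
   \prod_(i < n | (i != k) && (i != j)) polygauss s (p1 i) (y ord0 i - a * x ord0 i))) =
   (u x y k * polygauss s (p1 k) (y ord0 k - a * x ord0 k)) *
   ((u x y j * polygauss s (p1 j) (y ord0 j - a * x ord0 j)) *
   \prod_(i < n | (i != k) && (i != j)) polygauss s (p1 i) (y ord0 i - a * x ord0 i))); last by ring.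
have H i : polygauss s (- a *: polygauss_deriv s 1) (y ord0 i - a * x ord0 i) =
    u x y i * polygauss s (p1 i) (y ord0 i - a * x ord0 i).
  rewrite pd1 /polygauss /u mulrA; congr (_ * _).
  by rewrite hornerC hornerZ hornerX mulr1.
congr (_ * (_ * _)).
- by rewrite /dpoly eqxx eq_sym (negbTE jk) H.
- by rewrite /dpoly (negbTE jk) eqxx H.
- by apply: eq_bigr => i /andP[ik ij]; rewrite /dpoly (negbTE ij) (negbTE ik).
Qed.

Let pcst (c : R) (k : 'I_n) x : partial k (fun=> c) x = 0.
Proof. by rewrite /partial derive_cst. Qed.

Let b1 : bmeas (fun _ : 'rV[R]_n => 1 : R). Proof. exact: bmeas_cst. Qed.

(* The Gaussian moments come for free: they are derivatives of the constant
   total mass. *)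
Lemma gconv_one_dpoly1 j x : gconv a s (fun=> 1) (dpoly a s p1 j) x = 0.
Proof.
have [_ <-] := gconv_derive a s0 b1 p1 j x.
rewrite (_ : gconv a s _ _ = fun=> 1) ?pcst//.
by apply/funext => y; rewrite gconv_one.
Qed.

Lemma gconv_one_dpoly2 j k x :
  gconv a s (fun=> 1) (dpoly a s (dpoly a s p1 j) k) x = 0.
Proof.
have [_ <-] := gconv_derive a s0 b1 (dpoly a s p1 j) k x.
rewrite (_ : gconv a s _ _ = fun=> 0) ?pcst//.
by apply/funext => y; rewrite gconv_one_dpoly1.
Qed.

Lemma enorm_sqr (x : 'rV[R]_n) : enorm x ^+ 2 = \sum_(i < n) x ord0 i ^+ 2.
Proof. by rewrite /enorm sqr_sqrtr// sumr_ge0// => i _; rewrite sqr_ge0. Qed.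

(* Bessel's inequality for the orthonormal family of the normalised
   coordinates. *)
Lemma gradient_gconv_le (g : 'rV[R]_n -> R) x : a != 0 -> bmeas g ->
  enorm (gradient (gconv a s g p1) x) ^+ 2 <=
  (a / s) ^+ 2 * (gconv a s (fun y => g y ^+ 2) p1 x - gconv a s g p1 x ^+ 2).
Proof.
move=> a0 bg; have sn0 : s != 0 by rewrite gt_eqF.
rewrite enorm_sqr.
under eq_bigr => i _.
  rewrite mxE (proj2 (gconv_derive a s0 bg p1 i x)); over.
set c := fun i => gconv a s g (dpoly a s p1 i) x.
set m := gconv a s g p1 x; set S := \sum_i _.
have SE : S = \sum_i c i ^+ 2 by [].
(* The inverse variance of a score. Since [c j] is the covariance of [g] with the score [u x y j],
   the sum [l * \sum_j c j * u x y j] is the projection of [g - m] on the scores. *)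
pose l := (s / a) ^+ 2.
have hg p : has_Rintegral (lebesgue_rV n) (fun y => g y * gker a s p x y) (gconv a s g p x).
  by split => //; exact: integrable_gconv.
have hg2 : has_Rintegral (lebesgue_rV n) (fun y => g y ^+ 2 * gker a s p1 x y)
    (gconv a s (fun y => g y ^+ 2) p1 x).
  by split => //; exact: (integrable_gconv _ _ (bmeasX2 bg)).
have h1 p : has_Rintegral (lebesgue_rV n) (fun y => 1 * gker a s p x y) (gconv a s (fun=> 1) p x).
  by split => //; exact: (integrable_gconv _ _ b1).
(* The squared residual of the projection times the density, expanded into terms with known
   integrals. Products of scores are expressed by second derivatives of the kernel; the last term
   restores their diagonal part. *)
pose F y := g y ^+ 2 * gker a s p1 x y + (- (m *+ 2)) * (g y * gker a s p1 x y)
  + m ^+ 2 * (1 * gker a s p1 x y)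
  + (- (l *+ 2)) * (\sum_j c j * (g y * gker a s (dpoly a s p1 j) x y))
  + (l * m) *+ 2 * (\sum_j c j * (1 * gker a s (dpoly a s p1 j) x y))
  + l ^+ 2 * (\sum_j \sum_k (c j * c k) * (1 * gker a s (dpoly a s (dpoly a s p1 j) k) x y))
  + (l ^+ 2 * (a / s) ^+ 2 * S) * (1 * gker a s p1 x y).
have FE y : F y = (g y - m - l * \sum_j c j * u x y j) ^+ 2 * gker a s p1 x y.
  rewrite /F.
  under eq_bigr do rewrite gker_dpoly1.
  under [X in _ + _ *+ 2 * X]eq_bigr do rewrite gker_dpoly1.
  under [X in l ^+ 2 * X]eq_bigr => j _ do under eq_bigr do rewrite gker_dpoly2.
  set q := gker a s p1 x y.
  have -> : \sum_j c j * (g y * (u x y j * q)) = g y * q * \sum_j c j * u x y j.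
    by rewrite mulr_sumr; apply: eq_bigr => j _; ring.
  have -> : \sum_j c j * (1 * (u x y j * q)) = q * \sum_j c j * u x y j.
    by rewrite mulr_sumr; apply: eq_bigr => j _; ring.
  have -> : \sum_j \sum_k c j * c k * (1 * ((u x y j * u x y k - (j == k)%:R * (a / s) ^+ 2) * q)) =
     q * (\sum_j c j * u x y j) ^+ 2 - q * (a / s) ^+ 2 * S.
    rewrite [(\sum_j c j * _) ^+ 2]expr2 big_distrl/= SE !mulr_sumr -sumrB.
    apply: eq_bigr => j _; rewrite !mulr_sumr.
    rewrite (bigD1 j)//= [in RHS](bigD1 j)//= eqxx.
    under eq_bigr => k kj do rewrite eq_sym (negbTE kj) mul0r subr0.
    have -> : \sum_(k < n | k != j) c j * c k * (1 * (u x y j * u x y k * q)) =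
       \sum_(k < n | k != j) q * (c j * u x y j * (c k * u x y k)).
      by apply: eq_bigr => k _; ring.
    by rewrite (_ : true%:R = 1 :> R)//; ring.
  by ring.
have [Fi] : has_Rintegral (lebesgue_rV n) F
  (gconv a s (fun y => g y ^+ 2) p1 x + (- (m *+ 2)) * m + m ^+ 2 * gconv a s (fun=> 1) p1 x
  + (- (l *+ 2)) * (\sum_j c j * c j)
  + (l * m) *+ 2 * (\sum_j c j * gconv a s (fun=> 1) (dpoly a s p1 j) x)
  + l ^+ 2 * (\sum_j \sum_k (c j * c k) * gconv a s (fun=> 1) (dpoly a s (dpoly a s p1 j) k) x)
  + (l ^+ 2 * (a / s) ^+ 2 * S) * gconv a s (fun=> 1) p1 x).
  apply: has_RintegralD; last exact: has_RintegralZ.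
  apply: has_RintegralD; last first.
    apply: has_RintegralZ; apply: has_Rintegral_sum => j; apply: has_Rintegral_sum => k.
    exact: has_RintegralZ.
  apply: has_RintegralD; last first.
    by apply: has_RintegralZ; apply: has_Rintegral_sum => j; exact: has_RintegralZ.
  apply: has_RintegralD; last first.
    by apply: has_RintegralZ; apply: has_Rintegral_sum => j; exact: has_RintegralZ.
  apply: has_RintegralD; last exact: has_RintegralZ.
  by apply: has_RintegralD; last exact: has_RintegralZ.
rewrite gconv_one.
have -> : \sum_j c j * gconv a s (fun=> 1) (dpoly a s p1 j) x = 0.
  by apply: big1 => j _; rewrite gconv_one_dpoly1 mulr0.
have -> : \sum_j \sum_k (c j * c k) *
    gconv a s (fun=> 1) (dpoly a s (dpoly a s p1 j) k) x = 0.
  by apply: big1 => j _; apply: big1 => k _; rewrite gconv_one_dpoly2 mulr0.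
have -> : \sum_j c j * c j = S by rewrite SE; apply: eq_bigr => j _; rewrite expr2.
rewrite !mulr0 !addr0 !mulr1 => Fv.
have F0 : 0 <= \int[lebesgue_rV n]_y F y.
  apply: Rintegral_ge0 => y _; rewrite FE mulr_ge0 ?sqr_ge0// gker1// normal_rV_pdf_ge0//.
rewrite Fv in F0; move: F0.
have -> : l ^+ 2 * (a / s) ^+ 2 * S = l * S by rewrite /l; field; rewrite a0 sn0.
set V := gconv _ _ _ _ _ => F0.
have : l * S <= V - m ^+ 2 by move: F0; lra.
have as0 : 0 < (a / s) ^+ 2 by rewrite exprn_even_gt0//= mulf_neq0// invr_neq0.
rewrite -(ler_pM2l as0); apply: le_trans.
by rewrite mulrA /l (_ : (a / s) ^+ 2 * (s / a) ^+ 2 = 1) ?mul1r//; field; rewrite a0 sn0.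
Qed.

End normal_integral.

(** * The Poincare inequality on one component *)

Section bounded_L2.
Context d (T : measurableType d) (R : realType) (P : probability T R).
Implicit Types f : T -> R.

Let P1 : P setT = 1%E. Proof. exact: probability_setT. Qed.

Lemma bmeas_Lfun2 f : bmeas f -> f \in Lfun P 2%:E.
Proof.
move=> bf; apply/andP; split; first exact/mem_set/bmeas_measurable.
apply/mem_set; rewrite /= /finite_norm unlock; apply: poweR_lty.
have -> : (\int[P]_x (`|(EFin \o f) x| `^ 2) = \int[P]_x (f x ^+ 2)%:E)%E.
  by apply: eq_integral => x _ /=; rewrite powR_mulrn// real_normK// num_real.
by rewrite bmeas_EFin// ?ltry//; exact: bmeasX2.
Qed.

Lemma bmeas_variance f : bmeas f ->
  ('V_P[f] = (\int[P]_x (f x ^+ 2) - (\int[P]_x f x) ^+ 2)%:E)%E.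
Proof.
move=> bf; rewrite /variance unlock unlock.
have -> : fine (\int[P]_w (f w)%:E)%E = \int[P]_x f x by [].
set m := \int[P]_x f x.
transitivity (\int[P]_x ((f x - m) ^+ 2)%:E)%E.
  by apply: eq_integral => x _; rewrite expr2.
rewrite bmeas_EFin//; last by apply: bmeasX2; apply: bmeasB => //; exact: bmeas_cst.
rewrite bRint_sqrD// -/m; congr EFin; ring.
Qed.

End bounded_L2.

Section poincare.
Context {R : realType} (n : nat) (mu : probability 'rV[R]_n R) (CP : R).
Hypothesis muP : poincare mu CP.

Let mu1 : mu setT = 1%E. Proof. exact: probability_setT. Qed.

Lemma poincare_bmeas (f : 'rV[R]_n -> R) : smooth f -> bmeas f ->
  bmeas (fun x => enorm (gradient f x) ^+ 2) ->
  \int[mu]_x (f x ^+ 2) - (\int[mu]_x f x) ^+ 2 <=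
  CP * \int[mu]_x (enorm (gradient f x) ^+ 2).
Proof.
move=> sf bf bgf; have := muP sf (bmeas_Lfun2 _ bf).
by rewrite bmeas_variance// bmeas_EFin// -EFinM lee_fin.
Qed.

(* Test functions: the sine and cosine of a coordinate, whose squared
   gradients add up to 1. *)
Lemma poincare_ge0 : (0 < n)%N -> 0 <= CP.
Proof.
move=> n0; pose i : 'I_n := Ordinal n0.
(* Phase and amplitude are free so that the family is closed under partials: differentiating in
   direction [i] adds pi / 2 to the phase, and any other direction makes the amplitude 0. *)
pose w (c t : R) (x : 'rV[R]_n) := c * sin (x ord0 i + t).
have dw c t j x : derivable (w c t) x (delta_mx ord0 j) /\
    partial j (w c t) x = w (c * (i == j)%:R) (t + pi / 2) x.
  have D (u : R) : is_derive u (1 : R) (fun u : R => w c t (u *: delta_mx ord0 j + x))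
      (c * (cos (u * (i == j)%:R + x ord0 i + t) * (i == j)%:R)).
    have -> : (fun u : R => w c t (u *: delta_mx ord0 j + x)) =
        (fun u : R => c *: sin ((i == j)%:R *: u + (x ord0 i + t))).
      apply/funext => v; rewrite /w !mxE eqxx/= addrA [v * _]mulrC//.
    have d1 : is_derive u (1 : R) (fun u : R => (i == j)%:R *: u + (x ord0 i + t)) ((i == j)%:R).
      by apply: is_derive_eq; rewrite addr0 [_ *: 1]mulr1.
    have d2 := @is_derive1_comp R sin (fun u : R => (i == j)%:R *: u + (x ord0 i + t)) u _ _
      (is_derive_sin _) d1.
    have := is_deriveZ c d2; rewrite addrA [u * _]mulrC; exact.
  have xE : x = (0 : R) *: delta_mx ord0 j + x by rewrite scale0r add0r.
  have D0 := D 0; split.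
    by rewrite xE; apply: derivable_lineP; case: D0.
  rewrite {1}xE partial_lineE derive_val mul0r add0r /w addrA sinDpihalf.
  ring.
have bw c t : bmeas (w c t).
  split.
    apply: measurable_funM => //; apply: measurableT_comp => //.
      by apply: continuous_measurable_fun; exact: continuous_sin.
    by apply: measurable_funD => //; exact: measurable_coord.
  exists `|c| => x; rewrite /w normrM ler_piMr// ler_norml sin_geN1 sin_le1//.
have sw c t : smooth (w c t).
  apply: (@smooth_bounded_family R n (fun f => exists c t, f = w c t)).
  - by move=> _ [c' [t' ->]]; case: (bw c' t').
  - by move=> _ [c' [t' ->]] j x; case: (dw c' t' j x).
  - move=> _ j [c' [t' ->]]; exists (c' * (i == j)%:R), (t' + pi / 2).
    by apply/funext => x; case: (dw c' t' j x).
  - by exists c, t.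
have gw t x : enorm (gradient (w 1 t) x) ^+ 2 = cos (x ord0 i + t) ^+ 2.
  rewrite enorm_sqr (bigD1 i)//= big1 ?addr0 => [|j ji].
    by rewrite mxE (proj2 (dw _ _ _ _)) eqxx /w mulr1 mul1r addrA sinDpihalf.
  rewrite mxE (proj2 (dw _ _ _ _)) /w eq_sym (negbTE ji) mulr0 mul0r expr0n//.
have bgw t : bmeas (fun x => enorm (gradient (w 1 t) x) ^+ 2).
  have -> : (fun x => enorm (gradient (w 1 t) x) ^+ 2) = fun x => w 1 (t + pi / 2) x ^+ 2.
    by apply/funext => x; rewrite gw /w mul1r addrA sinDpihalf.
  exact: bmeasX2.
have key t : 0 <= CP * \int[mu]_x (enorm (gradient (w 1 t) x) ^+ 2).
  apply: le_trans (poincare_bmeas (sw 1 t) (bw 1 t) (bgw t)).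
  by rewrite -lee_fin -bmeas_variance// variance_ge0.
have := addr_ge0 (key 0) (key (pi / 2)).
rewrite -mulrDr -bRintD//.
have -> : (fun x => enorm (gradient (w 1 0) x) ^+ 2 + enorm (gradient (w 1 (pi / 2)) x) ^+ 2) = fun=> 1.
  by apply/funext => x; rewrite !gw addr0 cosDpihalf sqrrN cos2Dsin2.
by rewrite bRint_cst// mulr1.
Qed.

Variables (a s : R) (g : 'rV[R]_n -> R).
Hypotheses (a0 : a != 0) (s0 : 0 < s) (bg : bmeas g).
Let N : R.-pker 'rV[R]_n ~> 'rV[R]_n := normal_kernel a s.
Let h x := \int[N x]_y g y.

Lemma poincare_normal_kernel : 0 <= CP ->
  \int[mu]_x (h x ^+ 2) - (\int[mu]_x h x) ^+ 2 <=
  CP * (a / s) ^+ 2 *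
  (\int[mu]_x \int[N x]_y (g y ^+ 2) - \int[mu]_x (h x ^+ 2)).
Proof.
move=> CP0.
have hE : h = gconv a s g (fun=> 1).
  by apply/funext => x; exact: Rintegral_normal_kernel.
have bh : bmeas h by exact: bmeas_kernel.
have b2 : bmeas (fun x => \int[N x]_y (g y ^+ 2)) by apply: bmeas_kernel; exact: bmeasX2.
(* The partials of [h] are again Gaussian convolutions, hence bounded and continuous. *)
have bgrad : bmeas (fun x => enorm (gradient h x) ^+ 2).
  rewrite (_ : (fun x => _) = fun x => \sum_(i < n) gconv a s g (dpoly a s (fun=> 1) i) x ^+ 2); last first.
    apply/funext => x; rewrite enorm_sqr; apply: eq_bigr => i _.
    by rewrite mxE hE (proj2 (gconv_derive a s0 bg _ i x)).
  apply: bmeas_sum => i; apply: bmeasX2; split; last exact: gconv_bounded.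
  apply: continuous_measurable_rV.
  have [/(_ [::]) c _] := smooth_gconv a s0 bg (dpoly a s (fun=> 1) i) 0.
  exact: c.
have := poincare_bmeas _ bh bgrad; rewrite {1}hE => /(_ (smooth_gconv a s0 bg _)).
move=> /le_trans; apply; rewrite -mulrA ler_wpM2l//.
rewrite -bRintB//; last exact: bmeasX2.
rewrite -bRintZ//; last by apply: bmeasB => //; exact: bmeasX2.
apply: bRint_le => //.
  by apply: bmeasZ; apply: bmeasB => //; exact: bmeasX2.
move=> x; rewrite hE (Rintegral_normal_kernel a s0 x (bmeasX2 bg)).
exact: gradient_gconv_le.
Qed.

End poincare.

(** * Hellinger affinities of the noised components *)

Section cauchy_schwarz.
Context d (T : measurableType d) (R : realType) (mu : {measure set T -> \bar R}).
Hypothesis mu1 : mu setT = 1%E.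

Lemma discriminant_le (x y z : R) : 0 <= x ->
  (forall t, 0 <= t ^+ 2 * x - (t *+ 2) * y + z) -> y ^+ 2 <= x * z.
Proof.
rewrite le_eqVlt => /predU1P[<- h|x0 h].
  have [->|y0] := eqVneq y 0; first by rewrite expr0n mul0r.
  (* With [x = 0] the expression is affine in [t] with nonzero slope; this [t] gives it the value
     -1. *)
  have := h ((z + 1) / (y *+ 2)).
  have -> : ((z + 1) / (y *+ 2)) ^+ 2 * 0 - ((z + 1) / (y *+ 2)) *+ 2 * y + z = -1.
    by field.
  by rewrite ler0N1.
have := h (y / x).
have -> : (y / x) ^+ 2 * x - (y / x) *+ 2 * y + z = (x * z - y ^+ 2) / x.
  by field; rewrite gt_eqF.
by rewrite pmulr_lge0 ?invr_gt0// subr_ge0.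
Qed.

Lemma bRint_cauchy_schwarz (f g : T -> R) : bmeas f -> bmeas g ->
  (\int[mu]_x (f x * g x)) ^+ 2 <=
  \int[mu]_x (f x ^+ 2) * \int[mu]_x (g x ^+ 2).
Proof.
move=> bf bg; apply: discriminant_le.
  by apply: Rintegral_ge0 => x _; exact: sqr_ge0.
move=> t; have bf2 := bmeasX2 bf; have bg2 := bmeasX2 bg; have bfg := bmeasM bf bg.
rewrite -bRintZ// -bRintZ// -bRintB//; try exact: bmeasZ.
rewrite -bRintD//; last by apply: bmeasB; exact: bmeasZ.
apply: Rintegral_ge0 => x _.
have -> : t ^+ 2 * f x ^+ 2 - t *+ 2 * (f x * g x) + g x ^+ 2 = (t * f x - g x) ^+ 2.
  by ring.
exact: sqr_ge0.
Qed.

End cauchy_schwarz.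

Section noised_density.
Context {R : realType} (n : nat) (a s : R).
Hypothesis s0 : 0 < s.
Implicit Types (x y : 'rV[R]_n) (mu nu : probability 'rV[R]_n R).

Let q x y : R := normal_rV_pdf (a *: x) s y.
Let N : R.-pker 'rV[R]_n ~> 'rV[R]_n := normal_kernel a s.
Let sn0 : s != 0. Proof. by rewrite gt_eqF. Qed.

Definition noised mu y : R := \int[mu]_x q x y.

Let q0 x y : 0 <= q x y. Proof. exact: normal_rV_pdf_ge0. Qed.

Let measurable_q2 : measurable_fun setT (fun xy : 'rV[R]_n * 'rV[R]_n => q xy.1 xy.2).
Proof.
apply: measurable_prod => i _.
rewrite (_ : (fun _ => _) = fun xy : 'rV[R]_n * 'rV[R]_n =>
   normal_pdf 0 s (xy.2 ord0 i - a * xy.1 ord0 i)); last first.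
  by apply/funext => xy; rewrite normal_pdf0E// normal_pdfE// mxE.
apply: (measurableT_comp (measurable_normal_pdf 0 s)).
apply: measurable_funB; last apply: measurable_funM => //.
  by apply: (measurableT_comp (measurable_coord i)); exact: measurable_snd.
by apply: (measurableT_comp (measurable_coord i)); exact: measurable_fst.
Qed.

Let measurable_q_comp d (T : measurableType d) (f g : T -> 'rV[R]_n) :
  measurable_fun setT f -> measurable_fun setT g ->
  measurable_fun setT (fun t => q (f t) (g t)).
Proof.
move=> mf mg.
exact: (measurableT_comp measurable_q2 (measurable_fun_pair mf mg)).
Qed.

Let bq y : bmeas (q ^~ y).
Proof.
split.
  exact: (measurableT_comp measurable_q2
    (measurable_fun_pair (@measurable_id _ _ setT) (measurable_cst y))).
exists (normal_peak s ^+ n) => x; rewrite ger0_norm// /q /normal_rV_pdf.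
rewrite -[n in leRHS]card_ord -prodr_const; apply: ler_prod => i _.
by rewrite normal_pdf_ge0 normal_pdf_ub.
Qed.

Lemma noised_ge0 mu y : 0 <= noised mu y.
Proof. exact: Rintegral_ge0. Qed.

Lemma EFin_noised mu y : ((noised mu y)%:E = \int[mu]_x (q x y)%:E)%E.
Proof. by rewrite bmeas_EFin//; exact: probability_setT. Qed.

Lemma measurable_noised mu : measurable_fun setT (noised mu).
Proof.
apply/measurable_EFinP.
rewrite (_ : _ \o _ = fun y => \int[mu]_x (q x y)%:E)%E; last first.
  by apply/funext => y /=; rewrite EFin_noised.
apply: (@measurable_fun_fubini_tonelli_G _ _ _ _ _ mu (fun xy => (q xy.1 xy.2)%:E)) => //.
  exact/measurable_EFinP.
by move=> xy; rewrite lee_fin.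
Qed.

Lemma integral_noised mu (g : 'rV[R]_n -> R) : measurable_fun setT g ->
  (forall y, 0 <= g y) ->
  (\int[mu]_x \int[N x]_y (g y)%:E =
   \int[lebesgue_rV n]_y (g y * noised mu y)%:E)%E.
Proof.
move=> mg g0.
transitivity (\int[mu]_x \int[lebesgue_rV n]_y (q x y * g y)%:E)%E.
  apply: eq_integral => x _; rewrite ge0_integral_normal_rV//.
  exact/measurable_EFinP.
rewrite (@fubini_tonelli _ _ _ _ _ mu (lebesgue_rV n)
  (fun xy => (q xy.1 xy.2 * g xy.2)%:E)); last 2 first.
- apply/measurable_EFinP; apply: measurable_funM => //.
  by apply: (measurableT_comp mg); exact: measurable_snd.
- by move=> xy; rewrite lee_fin mulr_ge0.
apply: eq_integral => y _ /=; rewrite EFinM EFin_noised.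
under eq_integral do rewrite mulrC EFinM.
rewrite ge0_integralZl_EFin//.
- by move=> x _; rewrite lee_fin.
- by apply/measurable_EFinP; case: (bq y).
Qed.

Lemma Rintegral_noised mu (g : 'rV[R]_n -> R) : bmeas g ->
  (forall y, 0 <= g y) ->
  ((\int[mu]_x \int[N x]_y g y)%:E =
   \int[lebesgue_rV n]_y (g y * noised mu y)%:E)%E.
Proof.
move=> bg g0; rewrite -integral_noised//; last by case: bg.
rewrite -bmeas_EFin; last 2 first.
- exact: probability_setT.
- exact: bmeas_kernel.
by apply: eq_integral => x _; rewrite bmeas_EFin//; exact: prob_kernel.
Qed.

Lemma integral_noised1 mu : (\int[lebesgue_rV n]_y (noised mu y)%:E = 1)%E.
Proof.
have := Rintegral_noised mu (bmeas_cst _ 1) (fun _ => ler01).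
under [in RHS]eq_integral do rewrite mul1r.
move=> <-; congr EFin.
under eq_Rintegral do rewrite bRint_cst ?prob_kernel//.
by rewrite bRint_cst//; exact: probability_setT.
Qed.

(** The Bhattacharyya coefficient of the two laws of X_T started from [mu] and [nu]. *)
Definition affinity mu nu : \bar R :=
  (\int[lebesgue_rV n]_y (Num.sqrt (noised mu y * noised nu y))%:E)%E.

Let k (z : 'rV[R]_n * 'rV[R]_n) : R :=
  expR (- ((a / s) ^+ 2 / 8 * enorm (z.1 - z.2) ^+ 2)).

(** Parallelogram identity: |y - ax|^2 + |y - ax'|^2 is 2 |y - a(x + x')/2|^2 + a^2 |x - x'|^2 / 2.
    Dividing by 4 s^2 produces the constant 8 in [k]. *)
Lemma sqrt_normal_rV_pdf x x' y :
  Num.sqrt (q x y) * Num.sqrt (q x' y) =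
  k (x, x') * normal_rV_pdf (a *: (2^-1 *: (x + x'))) s y.
Proof.
rewrite -sqrtrM// /q /normal_rV_pdf -big_split/=.
rewrite /k enorm_sqr/= mulr_sumr -sumrN expR_sum -big_split/=.
rewrite -[RHS]ger0_norm; last first.
  by apply: prodr_ge0 => i _; rewrite mulr_ge0 ?expR_ge0 ?normal_pdf_ge0.
rewrite -sqrtr_sqr; congr Num.sqrt; rewrite -prodrXl; apply: eq_bigr => i _.
rewrite !normal_pdfE// /normal_fun !mxE.
set e := expR (- (_ / 8 * _)); set e1 := expR _; set e2 := expR _; set e3 := expR _.
have e12 : e1 * e2 = (e * e3) ^+ 2.
  rewrite /e /e1 /e2 /e3 [RHS]expr2 -!expRD; congr expR.
  by field.
by rewrite mulrACA e12; ring.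
Qed.

Lemma integral_sqrt_normal_rV_pdf x x' :
  (\int[lebesgue_rV n]_y (Num.sqrt (q x y) * Num.sqrt (q x' y))%:E = (k (x, x'))%:E)%E.
Proof.
under eq_integral do rewrite sqrt_normal_rV_pdf EFinM.
rewrite ge0_integralZl_EFin ?expR_ge0//.
- by rewrite integral_normal_rV_pdf mule1.
- by move=> y _; rewrite lee_fin normal_rV_pdf_ge0.
- by apply/measurable_EFinP; exact: measurable_normal_rV_pdf.
Qed.

Let measurable_sqrt : measurable_fun setT (@Num.sqrt R).
Proof. by apply: continuous_measurable_fun; exact: sqrt_continuous. Qed.

Let measurable_cost :
  measurable_fun setT (fun z : 'rV[R]_n * 'rV[R]_n => enorm (z.1 - z.2) ^+ 2).
Proof.
under eq_fun do rewrite enorm_sqr.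
apply: measurable_sum => i; apply: measurable_funX.
under eq_fun do rewrite !mxE; apply: measurable_funB.
  by apply: (measurableT_comp (measurable_coord i)); exact: measurable_fst.
by apply: (measurableT_comp (measurable_coord i)); exact: measurable_snd.
Qed.

Let bsqrt y : bmeas (fun x => Num.sqrt (q x y)).
Proof.
have [mq [M hM]] := bq y; split; first exact: measurableT_comp.
exists (Num.sqrt M) => x; rewrite ger0_norm ?sqrtr_ge0// ler_sqrt//.
  exact: le_trans (ler_norm _) (hM x).
exact: le_trans (normr_ge0 _) (hM x).
Qed.

Lemma coupling_Rintegral mu nu g : coupling mu nu g ->
  (forall f, bmeas f -> (forall x, 0 <= f x) ->
    \int[g]_z f z.1 = \int[mu]_x f x /\ \int[g]_z f z.2 = \int[nu]_x f x).
Proof.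
move=> cg f [mf _] f0; split; congr fine.
- apply: (@daniell_eq _ _ _ (fun f => \int[g]_z f z.1)%E (fun f => \int[mu]_x f x)%E).
  + apply: (@daniell_comp _ _ _ _ _ (fun f => \int[g]_z f z)%E fst) => //.
    exact: daniell_integral.
  + exact: daniell_integral.
  + move=> A mA; have mfA : measurable (fst @^-1` A : set ('rV[R]_n * 'rV[R]_n)).
      by rewrite -[X in measurable X]setTI; exact: measurable_fst.
    have [e1 e2] := cg A mA.
    have := integral_indic g measurableT mfA; rewrite setIT => e3.
    have := integral_indic mu measurableT mA; rewrite setIT => ->.
    exact: (etrans e3 e1).
  + exact/measurable_EFinP.
  + by move=> x; rewrite lee_fin.
- apply: (@daniell_eq _ _ _ (fun f => \int[g]_z f z.2)%E (fun f => \int[nu]_x f x)%E).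
  + apply: (@daniell_comp _ _ _ _ _ (fun f => \int[g]_z f z)%E snd) => //.
    exact: daniell_integral.
  + exact: daniell_integral.
  + move=> A mA; have mfA : measurable (snd @^-1` A : set ('rV[R]_n * 'rV[R]_n)).
      by rewrite -[X in measurable X]setTI; exact: measurable_snd.
    have [e1 e2] := cg A mA.
    have := integral_indic g measurableT mfA; rewrite setIT => e3.
    have := integral_indic nu measurableT mA; rewrite setIT => ->.
    exact: (etrans e3 e2).
  + exact/measurable_EFinP.
  + by move=> x; rewrite lee_fin.
Qed.

(** Joint concavity of the affinity: at each [y], Cauchy-Schwarz under [g] bounds the mean of the
    product of square roots by the root of the product of the noised densities. Integrating in [y]
    by Tonelli leaves [k] on the left. *)
Lemma affinity_coupling mu nu g : coupling mu nu g ->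
  (\int[g]_z (k z)%:E <= affinity mu nu)%E.
Proof.
move=> cg.
have g1 : g setT = 1%E by exact: probability_setT.
have mint : measurable_fun setT (fun zy : ('rV[R]_n * 'rV[R]_n) * 'rV[R]_n =>
    (Num.sqrt (q zy.1.1 zy.2) * Num.sqrt (q zy.1.2 zy.2))%:E).
  have m11 : measurable_fun setT (fun zy : ('rV[R]_n * 'rV[R]_n) * 'rV[R]_n => zy.1.1).
    exact: (measurableT_comp measurable_fst measurable_fst).
  have m12 : measurable_fun setT (fun zy : ('rV[R]_n * 'rV[R]_n) * 'rV[R]_n => zy.1.2).
    exact: (measurableT_comp measurable_snd measurable_fst).
  have m2 : measurable_fun setT (fun zy : ('rV[R]_n * 'rV[R]_n) * 'rV[R]_n => zy.2).
    exact: measurable_snd.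
  apply/measurable_EFinP; apply: measurable_funM.
    exact: (measurableT_comp measurable_sqrt (measurable_q_comp m11 m2)).
  exact: (measurableT_comp measurable_sqrt (measurable_q_comp m12 m2)).
have int0 (zy : ('rV[R]_n * 'rV[R]_n) * 'rV[R]_n) :
    (0 <= (Num.sqrt (q zy.1.1 zy.2) * Num.sqrt (q zy.1.2 zy.2))%:E)%E.
  by rewrite lee_fin mulr_ge0 ?sqrtr_ge0.
rewrite (_ : \int[g]_z (k z)%:E =
    \int[g]_z \int[lebesgue_rV n]_y (Num.sqrt (q z.1 y) * Num.sqrt (q z.2 y))%:E)%E; last first.
  by apply: eq_integral => -[x x'] _; rewrite integral_sqrt_normal_rV_pdf.
rewrite (@fubini_tonelli _ _ _ _ _ g (lebesgue_rV n)
  (fun zy => (Num.sqrt (q zy.1.1 zy.2) * Num.sqrt (q zy.1.2 zy.2))%:E)%E mint int0).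
apply: ge0_le_integral => //.
- by move=> y _; apply: integral_ge0 => z _; rewrite lee_fin mulr_ge0 ?sqrtr_ge0.
- apply: (@measurable_fun_fubini_tonelli_G _ _ _ _ _ g
    (fun zy => (Num.sqrt (q zy.1.1 zy.2) * Num.sqrt (q zy.1.2 zy.2))%:E)%E mint int0).
- apply/measurable_EFinP; apply: measurableT_comp => //.
  by apply: measurable_funM; exact: measurable_noised.
move=> y _ /=.
have b1 : bmeas (fun z : 'rV[R]_n * 'rV[R]_n => Num.sqrt (q z.1 y)).
  have [m [M hM]] := bsqrt y; split; last by exists M => z.
  by apply: (measurableT_comp m); exact: measurable_fst.
have b2 : bmeas (fun z : 'rV[R]_n * 'rV[R]_n => Num.sqrt (q z.2 y)).
  have [m [M hM]] := bsqrt y; split; last by exists M => z.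
  by apply: (measurableT_comp m); exact: measurable_snd.
rewrite bmeas_EFin//; last exact: bmeasM.
have [e1 _] := coupling_Rintegral cg (bq y) (q0 ^~ y).
have [_ e2] := coupling_Rintegral cg (bq y) (q0 ^~ y).
rewrite lee_fin; apply: (le_trans (ler_norm _)).
rewrite -sqrtr_sqr ler_wsqrtr//.
apply: (le_trans (bRint_cauchy_schwarz g1 b1 b2)).
under eq_Rintegral do rewrite sqr_sqrtr//.
under [X in _ * X <= _]eq_Rintegral do rewrite sqr_sqrtr//.
by rewrite e1 e2.
Qed.

(* Jensen's inequality for [expR (- x)], through the tangent line at the mean. *)
Lemma expR_cost_le_affinity mu nu g (c : R) : coupling mu nu g ->
  (\int[g]_z (enorm (z.1 - z.2) ^+ 2)%:E = c%:E)%E ->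
  ((expR (- ((a / s) ^+ 2 / 8 * c)))%:E <= affinity mu nu)%E.
Proof.
move=> cg gc; apply: le_trans (affinity_coupling cg).
have g1 : g setT = 1%E by exact: probability_setT.
pose b := (a / s) ^+ 2 / 8; rewrite -/b.
have b0 : 0 <= b by rewrite divr_ge0 ?sqr_ge0.
pose E := expR (- (b * c)).
have E0 : 0 <= E by exact: expR_ge0.
have c0 : 0 <= c.
  by rewrite -lee_fin -gc; apply: integral_ge0 => z _; rewrite lee_fin sqr_ge0.
have bk : bmeas k.
  split.
    apply: measurableT_comp => //; apply: measurableT_comp => //.
    exact: measurable_funM.
  exists 1 => z; rewrite ger0_norm ?expR_ge0// -expR0 ler_expR oppr_le0.
  by rewrite mulr_ge0 ?sqr_ge0.
(* The tangent inequality with its negative term moved to the other side, so that only nonnegative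
   integrands occur. *)
have : (\int[g]_z (E * (1 + b * c))%:E <=
    \int[g]_z ((k z)%:E + (E * b)%:E * (enorm (z.1 - z.2) ^+ 2)%:E))%E.
  apply: ge0_le_integral => //.
  - by move=> z _; rewrite lee_fin mulr_ge0// addr_ge0// mulr_ge0.
  - apply: emeasurable_funD; first by apply/measurable_EFinP; case: bk.
    by apply: emeasurable_funM => //; exact/measurable_EFinP.
  move=> z _; rewrite -EFinM -EFinD lee_fin /k -/b.
  set t := enorm _ ^+ 2.
  have -> : expR (- (b * t)) = E * expR (b * c - b * t).
    by rewrite /E -expRD; congr expR; ring.
  have : E * (1 + (b * c - b * t)) <= E * expR (b * c - b * t).
    by apply: ler_wpM2l => //; exact: expR_ge1Dx.
  lra.
rewrite (bmeas_EFin g1 (bmeas_cst _ (E * (1 + b * c)))) bRint_cst//.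
rewrite ge0_integralD//; last 4 first.
- by move=> z _; rewrite lee_fin expR_ge0.
- by apply/measurable_EFinP; case: bk.
- by move=> z _; rewrite -EFinM lee_fin; apply: mulr_ge0; [exact: mulr_ge0|exact: sqr_ge0].
- by apply: emeasurable_funM => //; exact/measurable_EFinP.
have Eb0 : 0 <= E * b by exact: mulr_ge0.
rewrite ge0_integralZl_EFin//; last 2 first.
- by move=> z _; rewrite lee_fin sqr_ge0.
- exact/measurable_EFinP.
rewrite gc bmeas_EFin// -EFinM -EFinD !lee_fin -/E.
by lra.
Qed.

End noised_density.

(** * Variance of a mixture from pairwise affinities *)

Lemma sum_pairs_sqr (R : comPzRingType) (C : finType) (b v : C -> R) :
  \sum_c \sum_c' b c * b c' * (v c - v c') ^+ 2 =
  ((\sum_c b c) * (\sum_c b c * v c ^+ 2) - (\sum_c b c * v c) ^+ 2) *+ 2.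
Proof.
have -> : \sum_c \sum_c' b c * b c' * (v c - v c') ^+ 2 =
  \sum_c \sum_c' (b c * v c ^+ 2 * b c') + \sum_c \sum_c' (b c * (b c' * v c' ^+ 2))
  - (\sum_c \sum_c' (b c * v c * (b c' * v c'))) *+ 2.
  rewrite -sumrMnl -big_split/= -sumrB; apply: eq_bigr => c _.
  rewrite -sumrMnl -big_split/= -sumrB; apply: eq_bigr => c' _.
  ring.
under eq_bigr do rewrite -mulr_sumr.
under [X in _ + X - _]eq_bigr do rewrite -mulr_sumr.
under [X in _ - X *+ 2]eq_bigr do rewrite -mulr_sumr.
rewrite -!mulr_suml; ring.
Qed.

Section pairwise_bound.
Context {R : realType} (C : finType) (w P u : C -> R) (g r : R).
Hypotheses (w0 : forall c, 0 < w c) (P0 : forall c, 0 <= P c).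

(** The estimate at one point [y], where [g] stands for g(y) and [P c] for the noised densities.
    Young's inequality r x <= x^2 / (2 S) + r^2 S / 2 is used with x = sqrt (P c P c') and S the
    mixture density; the quadratic terms form a variance under the weights [w c * P c]. *)
Lemma weighted_pairs_le :
  \sum_c \sum_c' w c * w c' * (u c - u c') ^+ 2 * r * Num.sqrt (P c * P c') <=
  \sum_c w c * ((g - u c) ^+ 2 * P c) +
  r ^+ 2 / 2 * (\sum_c \sum_c' w c * w c' * (u c - u c') ^+ 2) * \sum_c w c * P c.
Proof.
set S := \sum_c w c * P c.
have wP0 c : 0 <= w c * P c by rewrite mulr_ge0// ltW.
have S0 : 0 <= S by exact: sumr_ge0.
(* Where the mixture density vanishes, so does every [P c], since the weights are positive. *)
have := S0; rewrite le_eqVlt => /predU1P[S00|Sgt0].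
  have Pc c : P c = 0.
    have : w c * P c = 0 by apply: (psumr_eq0P (fun c _ => wP0 c) (esym S00)).
    by move=> /eqP; rewrite mulf_eq0 gt_eqF//= => /eqP.
  rewrite big1 => [|c _]; last by apply: big1 => c' _; rewrite Pc mul0r sqrtr0 mulr0.
  rewrite -S00 mulr0 addr0; apply: sumr_ge0 => c _.
  by rewrite Pc !mulr0.
have SE : \sum_c w c * P c = S by [].
clearbody S; pose d c c' := w c * w c' * (u c - u c') ^+ 2.
have d0 c c' : 0 <= d c c' by apply: mulr_ge0; [apply: mulr_ge0; exact: ltW|exact: sqr_ge0].
apply: (@le_trans _ _ (\sum_c \sum_c' d c c' * (P c * P c' / S / 2 + r ^+ 2 * S / 2))).
  apply: ler_sum => c _; apply: ler_sum => c' _.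
  rewrite -/(d c c') -mulrA ler_wpM2l//.
  set x := Num.sqrt _.
  have -> : P c * P c' = x ^+ 2 by rewrite sqr_sqrtr// mulr_ge0.
  have := sqr_ge0 (x - r * S) => h.
  have -> : x ^+ 2 / S / 2 + r ^+ 2 * S / 2 = r * x + (x - r * S) ^+ 2 / S / 2.
    by field; rewrite gt_eqF.
  by rewrite lerDl !divr_ge0.
under eq_bigr do under eq_bigr do rewrite mulrDr.
under eq_bigr do rewrite big_split/=.
rewrite big_split/= lerD//; last first.
  rewrite [leRHS]mulrAC mulr_sumr; apply: ler_sum => c _.
  rewrite mulr_sumr; apply: ler_sum => c' _; rewrite /d le_eqVlt.
  by apply/orP; left; apply/eqP; ring.
have -> : \sum_c \sum_c' d c c' * (P c * P c' / S / 2) =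
   (\sum_c \sum_c' (w c * P c) * (w c' * P c') * ((g - u c) - (g - u c')) ^+ 2) / S / 2.
  rewrite !mulr_suml; apply: eq_bigr => c _.
  rewrite !mulr_suml; apply: eq_bigr => c' _; rewrite /d.
  by field; rewrite gt_eqF.
(* Differences of centres are unchanged when recentred at [g], so a second moment about [g] appears;
   the square of the first moment is dropped. *)
rewrite sum_pairs_sqr SE.
have -> : \sum_c w c * P c * (g - u c) ^+ 2 = \sum_c w c * ((g - u c) ^+ 2 * P c).
  by apply: eq_bigr => c _; ring.
set X := \sum_c _ * (_ * _); set Y := \sum_c _.
have -> : (S * X - Y ^+ 2) *+ 2 / S / 2 = X - Y ^+ 2 / S by field; rewrite gt_eqF.
by rewrite gerBl divr_ge0// sqr_ge0.
Qed.

End pairwise_bound.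

Section mixture_variance.
Context {R : realType} (n : nat) (a s : R) (C : finType).
Variables (pc : C -> probability 'rV[R]_n R) (w : C -> R) (r : R).
Hypotheses (s0 : 0 < s) (w0 : forall c, 0 < w c) (w1 : \sum_c w c = 1).
Hypotheses (r0 : 0 <= r) (r1 : r <= 1).
Hypothesis rho : forall c c', (r%:E <= affinity a s (pc c) (pc c'))%E.
Let N : R.-pker 'rV[R]_n ~> 'rV[R]_n := normal_kernel a s.

Variable g : 'rV[R]_n -> R.
Hypothesis bg : bmeas g.
Let A c := \int[pc c]_x \int[N x]_y (g y ^+ 2).
Let nu c := \int[pc c]_x \int[N x]_y g y.

(** The right side is the weighted sum of E_c (g(X_T) - u_c)^2: components that overlap cannot all
    keep [g] close to distant centres. It is [weighted_pairs_le] integrated over [y]. *)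
Lemma mixture_sqr_dist_ge (u : C -> R) :
  r ^+ 2 * (\sum_c w c * u c ^+ 2 - (\sum_c w c * u c) ^+ 2) <=
  \sum_c w c * (A c - u c * nu c *+ 2 + u c ^+ 2).
Proof.
have pc1 c : pc c setT = 1%E by exact: probability_setT.
have N1 x : N x setT = 1%E by exact: prob_kernel.
have bgu c : bmeas (fun y => (g y - u c) ^+ 2).
  by apply: bmeasX2; apply: bmeasB => //; exact: bmeas_cst.
have AE c : A c - u c * nu c *+ 2 + u c ^+ 2 = \int[pc c]_x \int[N x]_y ((g y - u c) ^+ 2).
  rewrite (_ : (fun x => \int[N x]_y ((g y - u c) ^+ 2)) =
    (fun x => \int[N x]_y (g y ^+ 2) - (u c *+ 2) * \int[N x]_y g y + u c ^+ 2)); last first.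
    by apply/funext => x; rewrite bRint_sqrD//; ring.
  have b2 : bmeas (fun x => \int[N x]_y (g y ^+ 2)) by apply: bmeas_kernel; exact: bmeasX2.
  have b1 : bmeas (fun x => \int[N x]_y g y) by exact: bmeas_kernel.
  rewrite (bRintD (pc1 c)); last 2 first.
  - by apply: bmeasB => //; exact: bmeasZ.
  - exact: bmeas_cst.
  rewrite (bRint_cst (pc1 c)) (bRintB (pc1 c))//; last exact: bmeasZ.
  by rewrite (bRintZ (pc1 c))// /A /nu; ring.
under [leRHS]eq_bigr do rewrite AE.
set D := \sum_c \sum_c' w c * w c' * (u c - u c') ^+ 2.
have DE : D = (\sum_c w c * u c ^+ 2 - (\sum_c w c * u c) ^+ 2) *+ 2.
  by rewrite /D sum_pairs_sqr w1 mul1r.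
have d0 c c' : 0 <= w c * w c' * (u c - u c') ^+ 2.
  by apply: mulr_ge0; [apply: mulr_ge0; exact: ltW|exact: sqr_ge0].
have D0 : 0 <= D by apply: sumr_ge0 => c _; exact: sumr_ge0.
(* One [r] is the coefficient in the pointwise estimate, the other the lower bound on the
   affinities. Half of the left side cancels against [r ^+ 2 / 2 * D], and [D] is twice the variance
   of the centres. *)
suff : ((r * D * r)%:E <= (\sum_c w c * \int[pc c]_x \int[N x]_y ((g y - u c) ^+ 2)
    + r ^+ 2 / 2 * D)%:E)%E.
  by rewrite lee_fin DE; lra.
pose P c := noised a s (pc c).
have P0 c y : 0 <= P c y by exact: noised_ge0.
have mP c : measurable_fun setT (P c) by exact: measurable_noised.
have mS c c' : measurable_fun setT (fun y => Num.sqrt (P c y * P c' y)).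
  apply: measurableT_comp; last exact: measurable_funM.
  by apply: continuous_measurable_fun; exact: sqrt_continuous.
have wc0 c : 0 <= w c by exact: ltW.
apply: (@le_trans _ _ (\int[lebesgue_rV n]_y (\sum_c \sum_c'
    w c * w c' * (u c - u c') ^+ 2 * r * Num.sqrt (P c y * P c' y))%:E)%E).
  under eq_integral do rewrite -sumEFin.
  rewrite ge0_integral_sum//; last 2 first.
  - move=> c; apply/measurable_EFinP; apply: measurable_sum => c'.
    exact: measurable_funM.
  - move=> c y _; rewrite lee_fin; apply: sumr_ge0 => c' _.
    by rewrite mulr_ge0 ?sqrtr_ge0// mulr_ge0.
  rewrite /D mulr_sumr mulr_suml -sumEFin; apply: lee_sum => c _.
  under eq_integral do rewrite -sumEFin.
  rewrite ge0_integral_sum//; last 2 first.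
  - by move=> c'; apply/measurable_EFinP; exact: measurable_funM.
  - by move=> c' y _; rewrite lee_fin mulr_ge0 ?sqrtr_ge0// mulr_ge0.
  rewrite mulr_sumr mulr_suml -sumEFin; apply: lee_sum => c' _.
  under eq_integral do rewrite EFinM.
  have dr0 : 0 <= w c * w c' * (u c - u c') ^+ 2 * r by exact: mulr_ge0.
  rewrite ge0_integralZl_EFin//; [|exact/measurable_EFinP].
  rewrite (_ : r * _ * r = w c * w c' * (u c - u c') ^+ 2 * r * r); last by ring.
  by rewrite EFinM; apply: lee_wpmul2l; [rewrite lee_fin|exact: rho].
have mG c : measurable_fun setT (fun y => (g y - u c) ^+ 2 * P c y).
  by apply: measurable_funM => //; exact: bmeas_measurable.
have rD0 : 0 <= r ^+ 2 / 2 * D by rewrite mulr_ge0// divr_ge0// sqr_ge0.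
apply: (@le_trans _ _ (\int[lebesgue_rV n]_y ((\sum_c w c * ((g y - u c) ^+ 2 * P c y))%:E
    + (r ^+ 2 / 2 * D)%:E * (\sum_c w c * P c y)%:E))%E).
  apply: ge0_le_integral => //.
  - move=> y _; rewrite lee_fin; apply: sumr_ge0 => c _; apply: sumr_ge0 => c' _.
    by rewrite mulr_ge0 ?sqrtr_ge0// mulr_ge0.
  - apply/measurable_EFinP; apply: measurable_sum => c; apply: measurable_sum => c'.
    exact: measurable_funM.
  - apply: emeasurable_funD.
      by apply/measurable_EFinP; apply: measurable_sum => c; exact: measurable_funM.
    apply: emeasurable_funM => //.
    by apply/measurable_EFinP; apply: measurable_sum => c; exact: measurable_funM.
  - by move=> y _; rewrite -EFinM -EFinD lee_fin; exact: weighted_pairs_le.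
have sum_int (F : C -> 'rV[R]_n -> R) (v : C -> R) :
    (forall c, measurable_fun setT (F c)) -> (forall c y, 0 <= F c y) ->
    (forall c, (\int[lebesgue_rV n]_y (F c y)%:E = (v c)%:E)%E) ->
    (\int[lebesgue_rV n]_y (\sum_c w c * F c y)%:E = (\sum_c w c * v c)%:E)%E.
  move=> mF F0 Fv.
  under eq_integral do rewrite -sumEFin.
  rewrite ge0_integral_sum//; last 2 first.
  - by move=> c; apply/measurable_EFinP; exact: measurable_funM.
  - by move=> c y _; rewrite lee_fin mulr_ge0.
  rewrite -sumEFin; apply: eq_bigr => c _.
  under eq_integral do rewrite EFinM.
  rewrite ge0_integralZl_EFin//; last 2 first.
  - by move=> y _; rewrite lee_fin.
  - exact/measurable_EFinP.
  by rewrite Fv EFinM.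
have mwG : measurable_fun setT (fun y => (\sum_c w c * ((g y - u c) ^+ 2 * P c y))%:E : \bar R).
  by apply/measurable_EFinP; apply: measurable_sum => c; exact: measurable_funM.
have mwP : measurable_fun setT (fun y => (\sum_c w c * P c y)%:E : \bar R).
  by apply/measurable_EFinP; apply: measurable_sum => c; exact: measurable_funM.
rewrite ge0_integralD//; last 3 first.
- move=> y _; rewrite lee_fin; apply: sumr_ge0 => c _.
  by apply: mulr_ge0 => //; apply: mulr_ge0 => //; exact: sqr_ge0.
- move=> y _; rewrite -EFinM lee_fin mulr_ge0//; apply: sumr_ge0 => c _.
  by rewrite mulr_ge0.
- exact: emeasurable_funM.
rewrite ge0_integralZl_EFin//; last first.
  by move=> y _; rewrite lee_fin; apply: sumr_ge0 => c _; rewrite mulr_ge0.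
rewrite (sum_int _ (fun c => \int[pc c]_x \int[N x]_y ((g y - u c) ^+ 2)))//; last 2 first.
- by move=> c y; apply: mulr_ge0 => //; exact: sqr_ge0.
- by move=> c; rewrite -Rintegral_noised// => y; exact: sqr_ge0.
rewrite (sum_int _ (fun=> 1))//; last by move=> c; exact: integral_noised1.
have -> : \sum_c w c * 1 = 1 by rewrite -[RHS]w1; apply: eq_bigr => c _; rewrite mulr1.
by rewrite mule1 -EFinD.
Qed.

(** The total variance splits as [Vw + Vb], within plus between components. Centres placed at
    [m + t * (nu c - m)] give a family of inequalities in [t] relating [Vb] to [Vw]. *)
Lemma mixture_within_variance :
  r ^+ 2 * (\sum_c w c * A c - (\sum_c w c * nu c) ^+ 2) <=
  \sum_c w c * (A c - nu c ^+ 2).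
Proof.
pose m := \sum_c w c * nu c; rewrite -/m.
pose Vw := \sum_c w c * (A c - nu c ^+ 2).
pose Vb := \sum_c w c * (nu c - m) ^+ 2.
have sumE (k0 k1 k2 : R) (f0 f1 f2 : C -> R) :
  \sum_c w c * (k0 * f0 c + k1 * f1 c + k2 * f2 c) =
  k0 * (\sum_c w c * f0 c) + k1 * (\sum_c w c * f1 c) + k2 * (\sum_c w c * f2 c).
  by rewrite !mulr_sumr -!big_split/=; apply: eq_bigr => c _; ring.
have sum1 : \sum_c w c * 1 = 1 by rewrite -[RHS]w1; apply: eq_bigr => c _; rewrite mulr1.
have VbE : Vb = \sum_c w c * nu c ^+ 2 - m ^+ 2.
  transitivity (\sum_c w c * (1 * nu c ^+ 2 + (- (m *+ 2)) * nu c + m ^+ 2 * 1)).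
    by apply: eq_bigr => c _; congr (_ * _); ring.
  by rewrite sumE sum1 -/m; ring.
have VwE : Vw = \sum_c w c * A c - \sum_c w c * nu c ^+ 2.
  by rewrite -sumrB; apply: eq_bigr => c _; rewrite mulrBr.
have -> : \sum_c w c * A c - m ^+ 2 = Vw + Vb by rewrite VbE VwE; ring.
rewrite -/Vw.
have Vb0 : 0 <= Vb by apply: sumr_ge0 => c _; rewrite mulr_ge0 ?sqr_ge0// ltW.
have Vw0 : 0 <= Vw.
  apply: sumr_ge0 => c _; apply: mulr_ge0; first exact: ltW.
  have pc1 : pc c setT = 1%E by exact: probability_setT.
  have N1 x : N x setT = 1%E by exact: prob_kernel.
  have bN : bmeas (fun x => \int[N x]_y g y) by exact: bmeas_kernel.
  have b2 : bmeas (fun x => \int[N x]_y (g y ^+ 2)) by apply: bmeas_kernel; exact: bmeasX2.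
  rewrite subr_ge0 /A /nu.
  have := bRint_cauchy_schwarz pc1 bN (bmeas_cst _ 1).
  rewrite expr1n bRint_cst// mulr1.
  under eq_Rintegral do rewrite mulr1.
  move=> /le_trans; apply; apply: bRint_le => //; first exact: bmeasX2.
  move=> x; have := bRint_cauchy_schwarz (N1 x) bg (bmeas_cst _ 1).
  rewrite expr1n bRint_cst// mulr1.
  by under eq_Rintegral do rewrite mulr1.
have r21 : r ^+ 2 <= 1 by rewrite expr_le1.
(* Without between-component variance the claim is [r ^+ 2 <= 1]; otherwise division by [Vb] is
   allowed. *)
have := Vb0; rewrite le_eqVlt => /predU1P[<-|Vbgt0].
  by rewrite addr0 ler_piMl.
have key t : r ^+ 2 * (t ^+ 2 * Vb) <= Vw + (1 - t) ^+ 2 * Vb.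
  have := mixture_sqr_dist_ge (fun c => m + t * (nu c - m)).
  have -> : \sum_c w c * (m + t * (nu c - m)) ^+ 2 - (\sum_c w c * (m + t * (nu c - m))) ^+ 2
     = t ^+ 2 * Vb.
    have -> : \sum_c w c * (m + t * (nu c - m)) = m.
      transitivity (\sum_c w c * ((m * (1 - t)) * 1 + t * nu c + 0 * 0)).
        by apply: eq_bigr => c _; congr (_ * _); ring.
      by rewrite sumE sum1 -/m; ring.
    transitivity (\sum_c w c * ((m * (1 - t)) ^+ 2 * 1 + (m * (1 - t) * t *+ 2) * nu c + t ^+ 2 * nu c ^+ 2) - m ^+ 2).
      by congr (_ - _); apply: eq_bigr => c _; congr (_ * _); ring.
    by rewrite sumE sum1 -/m VbE; ring.
  have -> // : \sum_c w c * (A c - (m + t * (nu c - m)) * nu c *+ 2 + (m + t * (nu c - m)) ^+ 2)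
    = Vw + (1 - t) ^+ 2 * Vb.
  rewrite /Vw /Vb mulr_sumr -big_split/=; apply: eq_bigr => c _; ring.
(* The value of [t] for which the inequality [key] is sharpest. *)
have := key ((Vw + Vb) / Vb).
have -> : (Vw + Vb) / Vb = 1 + Vw / Vb by field; rewrite gt_eqF.
have -> : (1 + Vw / Vb) ^+ 2 * Vb = (Vw + Vb) * ((Vw + Vb) / Vb) by field; rewrite gt_eqF.
have -> : Vw + (1 - (1 + Vw / Vb)) ^+ 2 * Vb = Vw * ((Vw + Vb) / Vb) by field; rewrite gt_eqF.
by rewrite mulrA ler_pM2r// divr_gt0// ltr_wpDl.
Qed.

End mixture_variance.

(** * Spectral gap of a composed kernel *)

Section truncation.
Context d (T : measurableType d) (R : realType).
Implicit Type f : T -> R.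

Definition trunc (n : nat) f : T -> R :=
  fun x => if `|f x| <= n%:R then f x else 0.

Lemma trunc_le n f x : `|trunc n f x| <= `|f x|.
Proof. by rewrite /trunc; case: ifP => // _; rewrite normr0. Qed.

Lemma trunc_sqr_le n f x : trunc n f x ^+ 2 <= f x ^+ 2.
Proof. by rewrite /trunc; case: ifP => // _; rewrite expr0n sqr_ge0. Qed.

Lemma bmeas_trunc n f : measurable_fun setT f -> bmeas (trunc n f).
Proof.
move=> mf; split.
  apply: measurable_fun_ifT => //; apply: measurable_fun_ler => //.
  exact: measurableT_comp.
by exists n%:R => x; rewrite /trunc; case: ifP => // _; rewrite normr0.
Qed.

Lemma near_trunc f x : \forall n \near \oo, trunc n f x = f x.
Proof.
exists (Num.truncn `|f x|).+1 => // n /= xn.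
rewrite /trunc ifT//; have /andP[_] := truncn_itv (normr_ge0 (f x)).
by move=> /ltW /le_trans; apply; rewrite ler_nat.
Qed.

Lemma cvg_trunc f x : trunc n f x @[n --> \oo] --> f x.
Proof. by apply: cvg_near_cst; exact: near_trunc. Qed.

End truncation.

(** The dominating function is extended-real valued because the integral of a square against [P x]
    may be infinite on a null set of [x]. *)
Lemma Rintegral_dominated_cvg d (T : measurableType d) (R : realType)
    (mu : {measure set T -> \bar R}) (f_ : nat -> T -> R) (f : T -> R)
    (g : T -> \bar R) :
  (forall n, measurable_fun setT (f_ n)) -> measurable_fun setT f ->
  {ae mu, forall x, f_ ^~ x @ \oo --> f x} ->
  mu.-integrable setT g ->
  (forall x n, (`|f_ n x|%:E <= g x)%E) ->
  \int[mu]_x f_ n x @[n --> \oo] --> \int[mu]_x f x.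
Proof.
move=> mf_ mf ff ig fg.
have [|||//||fi _ h] := @dominated_convergence _ _ _ mu _ measurableT
  (fun n => EFin \o f_ n) (EFin \o f) g.
- by move=> n; exact/measurable_EFinP.
- exact/measurable_EFinP.
- apply: filterS ff => x fx _; apply: cvg_EFin => //.
  exact: nearW.
- by apply: aeW => x n _; exact: fg.
apply: fine_cvg; move: h; rewrite [X in _ --> X](_ : _ = (\int[mu]_x f x)%:E)//.
by rewrite /Rintegral fineK//; exact: integrable_fin_num.
Qed.

Section spectral_contraction.
Context d d' (X : measurableType d) (Y : measurableType d') (R : realType).
Variables (p : probability X R) (Q : R.-pker X ~> Y) (K : R.-pker Y ~> X).
Hypothesis pQK : is_conditional_law p Q K.
Let P := mkcomp_noparam Q K.

Let p1 : p setT = 1%E. Proof. exact: probability_setT. Qed.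
Let Q1 x : Q x setT = 1%E. Proof. exact: prob_kernel. Qed.
Let PP1 x : P x setT = 1%E. Proof. exact: mkcomp_noparam_setT. Qed.

Lemma measurable_integral_mkcomp (f : X -> \bar R) : measurable_fun setT f ->
  (forall x, 0 <= f x)%E -> measurable_fun setT (fun x => \int[P x]_y f y)%E.
Proof.
move=> mf f0.
rewrite (_ : (fun x => \int[P x]_y f y)%E = (fun x => \int[Q x]_y \int[K y]_z f z)%E); last first.
  by apply/funext => x; exact: ge0_integral_mkcomp_noparam.
apply: measurable_integral_kernel; first exact: measurable_integral_kernel.
by move=> y; exact: integral_ge0.
Qed.

Lemma invariant_mkcomp (f : X -> \bar R) : measurable_fun setT f ->
  (forall x, 0 <= f x)%E ->
  (\int[p]_x \int[P x]_y f y = \int[p]_x f x)%E.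
Proof.
move=> mf f0.
transitivity (\int[p]_x (Q x setT * f x))%E; last first.
  by apply: eq_integral => x _; rewrite prob_kernel mul1e.
rewrite (conditional_law_integral0 pQK measurableT mf f0).
apply: eq_integral => x _; rewrite /P ge0_integral_mkcomp_noparam//.
by apply: eq_integral => y _; rewrite indicT mul1e.
Qed.

Variable b : R.
Hypothesis b0 : 0 <= b.
Hypothesis contraction : forall g : Y -> R, bmeas g ->
  \int[p]_x ((\int[Q x]_y g y) ^+ 2) - (\int[p]_x \int[Q x]_y g y) ^+ 2 <=
  b * (\int[p]_x \int[Q x]_y (g y ^+ 2) - (\int[p]_x \int[Q x]_y g y) ^+ 2).

(** For [g = K f], adjointness identifies [v] with Var g(Y), and Cauchy-Schwarz gives v^2 <= Vf W
    with W the variance of [Q g]. The hypothesis W <= b v then allows one factor [v] to be cancelled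
    when it is positive. *)
Lemma bmeas_spectral_contraction (f : X -> R) : bmeas f ->
  \int[p]_x (f x * \int[P x]_y f y) - (\int[p]_x f x) ^+ 2 <=
  b * (\int[p]_x (f x ^+ 2) - (\int[p]_x f x) ^+ 2).
Proof.
move=> bf; pose g y := \int[K y]_z f z.
have bg : bmeas g by exact: bmeas_kernel.
have bQg : bmeas (fun x => \int[Q x]_y g y) by exact: bmeas_kernel.
set e := \int[p]_x f x.
have eE : \int[p]_x \int[Q x]_y g y = e by exact: conditional_law_Rintegral_kernel.
have fP : \int[p]_x (f x * \int[P x]_y f y) = \int[p]_x (f x * \int[Q x]_y g y).
  by apply: eq_Rintegral => x _; rewrite /P Rintegral_mkcomp_noparam.
have vE : \int[p]_x (f x * \int[Q x]_y g y) = \int[p]_x \int[Q x]_y (g y ^+ 2).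
  rewrite (conditional_law_Rintegral pQK bf bg).
  by apply: eq_Rintegral => x _; apply: eq_Rintegral => y _; rewrite expr2.
have := contraction bg; rewrite fP eE -vE.
set W := \int[p]_x ((\int[Q x]_y g y) ^+ 2) - e ^+ 2.
set v := \int[p]_x (f x * \int[Q x]_y g y) - e ^+ 2 => h.
set Vf := \int[p]_x (f x ^+ 2) - e ^+ 2.
have be : bmeas (fun _ : X => e) by exact: bmeas_cst.
have CS := bRint_cauchy_schwarz p1 (bmeasB bf be) (bmeasB bQg be).
have VfE : \int[p]_x ((f x - e) ^+ 2) = Vf.
  by rewrite (bRint_sqrD p1)// /Vf -/e; ring.
have WE : \int[p]_x ((\int[Q x]_y g y - e) ^+ 2) = W.
  by rewrite (bRint_sqrD p1)// eE /W; ring.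
have vvE : \int[p]_x ((f x - e) * (\int[Q x]_y g y - e)) = v.
  have -> : (fun x => (f x - e) * (\int[Q x]_y g y - e)) =
    fun x => f x * \int[Q x]_y g y - e * f x - e * \int[Q x]_y g y + e ^+ 2.
    by apply/funext => x; ring.
  have bfQ := bmeasM bf bQg.
  have b1 := bmeasB bfQ (bmeasZ e bf); have b2 := bmeasB b1 (bmeasZ e bQg).
  rewrite (bRintD p1 b2 (bmeas_cst _ _)) (bRint_cst p1).
  rewrite (bRintB p1 b1 (bmeasZ e bQg)) (bRintB p1 bfQ (bmeasZ e bf)).
  by rewrite (bRintZ p1 _ bf) (bRintZ p1 _ bQg) eE -/e /v; ring.
rewrite VfE WE vvE in CS.
have Vf0 : 0 <= Vf by rewrite -VfE; apply: Rintegral_ge0 => x _; exact: sqr_ge0.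
have [v0|v0] := lerP v 0; first by rewrite (le_trans v0)// mulr_ge0.
rewrite -(ler_pM2r v0) -expr2 (le_trans CS)// -mulrA [b * _]mulrC -mulrA ler_wpM2l//.
by rewrite [v * _]mulrC.
Qed.

(** Limit of the bounded case along truncations. Their means need not vanish, but they tend to 0,
    which removes the squared means from the limit. *)
Lemma spectral_contraction_L2 (f : X -> R) : f \in Lfun p 2%:E ->
  ('E_p[f] = 0)%E -> L2_inner p f (kernel_op P f) <= b * L2_inner p f f.
Proof.
move=> fL2 Ef; have if2 := Lfun2_integrable_sqr fL2.
have mf : measurable_fun setT f.
  by move: fL2 => /andP[/set_mem].
have mf2 : measurable_fun setT (fun x => (f x ^+ 2)%:E : \bar R).
  by apply/measurable_EFinP; exact: measurable_funX.
have f20 x : (0 <= (f x ^+ 2)%:E :> \bar R)%E by rewrite lee_fin sqr_ge0.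
(* It dominates the products of a truncation with its image under [P], by Jensen for [P x], and
   stationarity of [p] makes it integrable. *)
pose G x : \bar R := ((f x ^+ 2)%:E + \int[P x]_y (f y ^+ 2)%:E)%E.
have mPf2 : measurable_fun setT (fun x => \int[P x]_y (f y ^+ 2)%:E)%E.
  exact: measurable_integral_mkcomp.
have Pf20 x : (0 <= \int[P x]_y (f y ^+ 2)%:E)%E by apply: integral_ge0.
have iPf2 : p.-integrable setT (fun x => \int[P x]_y (f y ^+ 2)%:E)%E.
  apply/integrableP; split => //.
  under eq_integral do rewrite gee0_abs//.
  rewrite invariant_mkcomp//.
  have /integrableP[_] := if2.
  by under eq_integral do rewrite /= ger0_norm ?sqr_ge0//.
have iG : p.-integrable setT G by exact: (integrableD measurableT if2 iPf2).
have i1 : p.-integrable setT (fun x => (1 + f x ^+ 2)%:E).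
  exact: (integrableD measurableT (bmeas_integrable p1 (bmeas_cst _ 1)) if2).
have abs_le (t : R) : `|t| <= 1 + t ^+ 2.
  by rewrite ler_norml; apply/andP; split; nra.
have mPf : measurable_fun setT (kernel_op P f).
  rewrite (_ : kernel_op P f = fun x => fine (\int[P x]_y ((EFin \o f)^\+ y) - \int[P x]_y ((EFin \o f)^\- y))%E); last first.
    by apply/funext => x; rewrite /kernel_op /Rintegral integralE.
  have mEf : measurable_fun setT (EFin \o f) by exact/measurable_EFinP.
  apply: measurableT_comp => //; apply: emeasurable_funB.
    by apply: measurable_integral_mkcomp => //; exact: measurable_funepos.
  by apply: measurable_integral_mkcomp => //; exact: measurable_funeneg.
pose F n := trunc n f.
have bF n : bmeas (F n) by exact: bmeas_trunc.
have cvgF x : F ^~ x @ \oo --> f x by exact: cvg_trunc.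
(* For almost every [x] the function [f] is square integrable under [P x], and [1 + f ^+ 2]
   dominates all truncations. *)
have Pcvg : {ae p, forall x, \int[P x]_y F n y @[n --> \oo] --> kernel_op P f x}.
  have := integrable_ae measurableT iPf2.
  apply: filterS => x /(_ I) fin.
  apply: (@Rintegral_dominated_cvg _ _ _ (P x) F f (fun y => (1 + f y ^+ 2)%:E)).
  - by move=> n; case: (bF n).
  - exact: mf.
  - by apply: aeW => y; exact: cvgF.
  - have c1 := bmeas_integrable (PP1 x) (bmeas_cst _ 1).
    have c2 : (P x).-integrable setT (EFin \o (fun y => f y ^+ 2)).
      apply/integrableP; split => //.
      under eq_integral do rewrite /= ger0_norm ?sqr_ge0//.
      by rewrite ltey_eq fin.
    exact: (integrableD measurableT c1 c2).
  - by move=> y n; rewrite lee_fin (le_trans (trunc_le n f y)).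
have cv1 : \int[p]_x (F n x * \int[P x]_y F n y) @[n --> \oo] --> L2_inner p f (kernel_op P f).
  apply: (@Rintegral_dominated_cvg _ _ _ p _ _ G) => //.
  - move=> n; apply: measurable_funM; first by case: (bF n).
    rewrite (_ : (fun x => \int[P x]_y F n y) = fun x => \int[Q x]_y \int[K y]_z F n z).
      exact: bmeas_measurable (bmeas_kernel Q (bmeas_kernel K (bF n))).
    by apply/funext => x; rewrite /P Rintegral_mkcomp_noparam.
  - exact: measurable_funM.
  - by apply: filterS Pcvg => x h; apply: cvgM.
  - move=> x n.
    apply: (@le_trans _ _ (F n x ^+ 2 + (\int[P x]_y F n y) ^+ 2)%:E).
      rewrite lee_fin normrM -(real_normK (num_real (F n x))).
      rewrite -(real_normK (num_real (\int[P x]_y F n y))).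
      have := sqr_ge0 (`|F n x| - `|\int[P x]_y F n y|).
      have := sqr_ge0 (`|F n x| + `|\int[P x]_y F n y|).
      by nra.
    rewrite EFinD /G leeD//; first by rewrite lee_fin trunc_sqr_le.
    apply: (@le_trans _ _ (\int[P x]_y (F n y ^+ 2)%:E)%E).
      rewrite (bmeas_EFin (PP1 x) (bmeasX2 (bF n))) lee_fin.
      have := bRint_cauchy_schwarz (PP1 x) (bF n) (bmeas_cst _ 1).
      rewrite expr1n (bRint_cst (PP1 x)) mulr1.
      by under eq_Rintegral do rewrite mulr1.
    apply: ge0_le_integral => //.
    + by move=> y _; rewrite lee_fin sqr_ge0.
    + by apply/measurable_EFinP; case: (bmeasX2 (bF n)).
    + by move=> y _; rewrite lee_fin trunc_sqr_le.
have cv2 : \int[p]_x (F n x ^+ 2) @[n --> \oo] --> L2_inner p f f.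
  rewrite (_ : L2_inner p f f = \int[p]_x (f x ^+ 2)); last first.
    by apply: eq_Rintegral => x _; rewrite expr2.
  apply: (@Rintegral_dominated_cvg _ _ _ p _ _ (EFin \o (fun x => f x ^+ 2))) => //.
  - by move=> n; case: (bmeasX2 (bF n)).
  - exact: measurable_funX.
  - by apply: aeW => x; under eq_fun do rewrite expr2; rewrite expr2; apply: cvgM.
  - by move=> x n; rewrite lee_fin ger0_norm ?sqr_ge0// trunc_sqr_le.
have cv3 : \int[p]_x F n x @[n --> \oo] --> (0 : R).
  rewrite (_ : 0 = \int[p]_x f x); last by move: Ef; rewrite unlock /Rintegral => ->.
  apply: (@Rintegral_dominated_cvg _ _ _ p F f (fun x => (1 + f x ^+ 2)%:E)) => //.
  - by move=> n; case: (bF n).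
  - by apply: aeW => y; exact: cvgF.
  - by move=> y n; rewrite lee_fin (le_trans (trunc_le n f y)).
have cv4 : (\int[p]_x F n x) ^+ 2 @[n --> \oo] --> (0 : R).
  by rewrite -[0 in X in _ --> X](mulr0 0); under eq_fun do rewrite expr2; apply: cvgM.
set V := L2_inner p f (kernel_op P f); set S := L2_inner p f f.
have L1 : \int[p]_x (F n x * \int[P x]_y F n y) - (\int[p]_x F n x) ^+ 2 @[n --> \oo] --> V.
  by rewrite -[V]subr0; exact: cvgB.
have L2 : b * (\int[p]_x (F n x ^+ 2) - (\int[p]_x F n x) ^+ 2) @[n --> \oo] --> b * S.
  by rewrite -[S]subr0; apply: cvgM; [exact: cvg_cst|exact: cvgB].
apply: (ler_cvg_to L1 L2); apply: nearW => n /=.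
exact: bmeas_spectral_contraction.
Qed.

Lemma spectral_gap_ge : ((1 - b)%:E <= spectral_gap p P)%E.
Proof.
rewrite /spectral_gap EFinB leeB//; apply: ge_ereal_sup => _ [f [fL2 Ef _] <-].
rewrite lee_fin; have L0 : 0 <= L2_inner p f f.
  by apply: Rintegral_ge0 => x _; rewrite -expr2 sqr_ge0.
have := spectral_contraction_L2 fL2 Ef.
(* A zero denominator makes the quotient 0 by convention, which is at most [b]. *)
have := L0; rewrite le_eqVlt => /predU1P[<-|Lgt0]; first by move=> _; rewrite invr0 mulr0.
by rewrite ler_pdivrMr.
Qed.

End spectral_contraction.

(** * Gaussian mixtures *)

Section mixture_integral.
Context d (T : measurableType d) (R : realType) (C : finType).
Variables (w : C -> R) (pc : C -> probability T R) (p : probability T R).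
Hypotheses (w0 : forall c, 0 <= w c) (pE : is_mixture w pc p).

Lemma ge0_integral_mixture (f : T -> \bar R) : measurable_fun setT f ->
  (forall x, 0 <= f x)%E ->
  (\int[p]_x f x = \sum_c (w c)%:E * \int[pc c]_x f x)%E.
Proof.
move=> mf f0.
have we0 c : (0 <= (w c)%:E)%E by rewrite lee_fin.
apply: (@daniell_eq _ _ _ (fun f => \int[p]_x f x)%E
  (fun f => \sum_c (w c)%:E * \int[pc c]_x f x)%E) => //.
- exact: daniell_integral.
- split.
  + move=> g h mg mh g0 h0; rewrite -big_split/=; apply: eq_bigr => c _.
    by rewrite ge0_integralD// ge0_muleDr//; exact: integral_ge0.
  + move=> k g k0 mg g0; rewrite ge0_sume_distrr; last first.
      by move=> c _; rewrite mule_ge0//; exact: integral_ge0.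
    by apply: eq_bigr => c _; rewrite ge0_integralZl_EFin// muleCA.
  + move=> f_ g mf_ f0_ nd cf.
    suff H (s : seq C) : ((fun f : T -> \bar R => \sum_(c <- s) (w c)%:E * \int[pc c]_x f x) \o f_ @ \oo -->
        \sum_(c <- s) (w c)%:E * \int[pc c]_x g x)%E by exact: H.
    have g0 x : (0 <= g x)%E.
      have /cvg_lim <- // := cf x; apply: lime_ge; first by apply/cvg_ex; exists (g x).
      by apply: nearW => n.
    elim: s => [|c s IH].
      rewrite big_nil; under eq_fun do rewrite /= big_nil; exact: cvg_cst.
    rewrite big_cons; under eq_fun do rewrite /= big_cons.
    apply: cvgeD => //.
      apply: ge0_adde_def; rewrite inE.
        by rewrite mule_ge0//; exact: integral_ge0.
      by apply: sume_ge0 => i _; rewrite mule_ge0//; exact: integral_ge0.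
    apply: cvgeZl => //.
    by have [_ _] := daniell_integral (pc c); exact.
- move=> A mA; transitivity (p A); first by rewrite integral_indic// setIT.
  rewrite pE//.
  by apply: eq_bigr => c _; rewrite integral_indic// setIT.
Qed.

Lemma Rintegral_mixture (f : T -> R) : bmeas f ->
  \int[p]_x f x = \sum_c w c * \int[pc c]_x f x.
Proof.
have pc1 c : pc c setT = 1%E by exact: probability_setT.
have p1 : p setT = 1%E by exact: probability_setT.
move: f; apply: (@bmeas_linear_ext _ _ _ (fun f => \int[p]_x f x)
  (fun f => \sum_c w c * \int[pc c]_x f x)).
- by move=> f g bf bg; rewrite (bRintB p1).
- move=> f g bf bg; rewrite -sumrB; apply: eq_bigr => c _.
  by rewrite (bRintB (pc1 c))// mulrBr.
- move=> f bf f0; apply: EFin_inj.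
  rewrite -(bmeas_EFin p1)// ge0_integral_mixture//; last first.
    by apply/measurable_EFinP; case: bf.
  rewrite -sumEFin; apply: eq_bigr => c _.
  by rewrite (bmeas_EFin (pc1 c)).
Qed.

End mixture_integral.

(** * From Wasserstein distance to affinity *)

Section wasserstein_affinity.
Context {R : realType} (n : nat) (a s : R).
Hypothesis s0 : 0 < s.

Lemma expR_wasserstein_le_affinity (mu nu : probability 'rV[R]_n R) (m : R) :
  (wasserstein2 mu nu ^+ 2 <= m%:E)%E ->
  ((expR (- ((a / s) ^+ 2 / 8 * m)))%:E <= affinity a s mu nu)%E.
Proof.
rewrite /wasserstein2; set W := [set _ | _ in _].
have W0 x : W x -> (0 <= x)%E.
  by move=> [g _ <-]; apply: integral_ge0 => z _; rewrite lee_fin sqr_ge0.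
have inf0 : (0 <= ereal_inf W)%E by apply: le_ereal_inf_tmp => x /W0.
have -> : ((ereal_inf W `^ 2^-1) ^+ 2 = ereal_inf W)%E.
  by rewrite poweR12_sqrt// sqr_sqrte.
move=> Wm; pose b := (a / s) ^+ 2 / 8; rewrite -/b.
have b0 : 0 <= b by rewrite divr_ge0 ?sqr_ge0.
have m0 : 0 <= m by rewrite -lee_fin (le_trans inf0).
have inffin : ereal_inf W \is a fin_num.
  by rewrite ge0_fin_numE// (le_lt_trans Wm)// ltry.
apply/lee_addgt0Pr => e e0.
(* A coupling within this slack of the infimum loses at most [e] in the affinity, because exp(-t) >=
   1 - t, [E <= 1] and b e / (b + 1) <= e. *)
have e1 : 0 < e / (b + 1) by rewrite divr_gt0// ltr_wpDl.
have [x [g cg gx] xlt] := lb_ereal_inf_adherent e1 inffin.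
have x0 : (0 <= x)%E by apply: W0; exists g.
have xle : (x <= (m + e / (b + 1))%:E)%E.
  by rewrite (le_trans (ltW xlt))// EFinD leeD2r.
have xfin : x \is a fin_num by rewrite ge0_fin_numE// (le_lt_trans xle)// ltry.
have gc : (\int[g]_z (enorm (z.1 - z.2) ^+ 2)%:E = (fine x)%:E)%E by rewrite fineK.
have := expR_cost_le_affinity a s0 cg gc; rewrite -/b => h.
apply: (le_trans _ (leeD2r e%:E h)).
rewrite -EFinD lee_fin -lerBlDr.
have fx : fine x <= m + e / (b + 1) by rewrite -lee_fin fineK.
apply: (@le_trans _ _ (expR (- (b * (m + e / (b + 1)))))); last first.
  by rewrite ler_expR lerN2 ler_wpM2l.
have -> : - (b * (m + e / (b + 1))) = - (b * m) + - (b * (e / (b + 1))) by ring.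
rewrite expRD; set E := expR (- (b * m)).
have E0 : 0 <= E by exact: expR_ge0.
have E1 : E <= 1 by rewrite -expR0 ler_expR oppr_le0 mulr_ge0.
have be : b * (e / (b + 1)) <= e.
  by rewrite mulrCA ler_piMr ?(ltW e0)// ler_pdivrMr ?mul1r ?lerDl// ltr_wpDl.
have be0 : 0 <= b * (e / (b + 1)) by rewrite mulr_ge0// ltW.
have h1 : E * (1 + - (b * (e / (b + 1)))) <= E * expR (- (b * (e / (b + 1)))).
  by apply: ler_wpM2l => //; exact: expR_ge1Dx.
apply: le_trans h1.
move: be be0; set t := b * _ => te t0.
nra.
Qed.

End wasserstein_affinity.

(* The supremum is taken over the empty set. *)
Lemma spectral_gap_rV0 (R : realType) (p : probability 'rV[R]_0 R)
  (P : 'rV[R]_0 -> {measure set 'rV[R]_0 -> \bar R}) : spectral_gap p P = +oo%E.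
Proof.
rewrite /spectral_gap (_ : [set _ | _ in _] = set0) ?ereal_sup0//.
apply/seteqP; split => // y [f [_ Ef f0] _]; apply: f0.
have fE x : f x = f 0 by rewrite [x]thinmx0.
have : ('E_p[cst (f 0%R)] = 0)%E by rewrite -Ef; congr expectation; apply/funext.
by rewrite expectation_cst => -[f00]; apply: aeW => x; rewrite fE.
Qed.

(** * Contraction for the mixture and the final bound *)

Section gaussian_mixture_contraction.
Context {R : realType} (n : nat) (C : finType) (a s CP r : R).
Variables (pc : C -> probability 'rV[R]_n R) (w : C -> R) (p : probability 'rV[R]_n R).
Hypotheses (a0 : a != 0) (s0 : 0 < s) (CP0 : 0 <= CP).
Hypotheses (pcP : forall c, poincare (pc c) CP).
Hypotheses (w0 : forall c, 0 < w c) (w1 : \sum_c w c = 1).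
Hypotheses (pE : is_mixture w pc p).
Hypotheses (r0 : 0 <= r) (r1 : r <= 1).
Hypothesis rho : forall c c', (r%:E <= affinity a s (pc c) (pc c'))%E.
Let N : R.-pker 'rV[R]_n ~> 'rV[R]_n := normal_kernel a s.

(** Adding [A c - H c] to both sides of the component inequality gives
    [A c - nu c ^+ 2 <= k * (A c - H c)]. Averaging over [c] and applying [mixture_within_variance]
    bounds [SA - SH] from below; subtraction from the total variance gives the claim. *)
Lemma mixture_contraction (g : 'rV[R]_n -> R) : bmeas g ->
  \int[p]_x ((\int[N x]_y g y) ^+ 2) - (\int[p]_x \int[N x]_y g y) ^+ 2 <=
  (1 - r ^+ 2 * (1 + (a / s) ^+ 2 * CP)^-1) *
  (\int[p]_x \int[N x]_y (g y ^+ 2) - (\int[p]_x \int[N x]_y g y) ^+ 2).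
Proof.
move=> bg.
have wc0 c : 0 <= w c by exact: ltW.
have bN : bmeas (fun x => \int[N x]_y g y) by exact: bmeas_kernel.
have b2 : bmeas (fun x => \int[N x]_y (g y ^+ 2)) by apply: bmeas_kernel; exact: bmeasX2.
rewrite !(Rintegral_mixture wc0 pE)//; last exact: bmeasX2.
pose A c := \int[pc c]_x \int[N x]_y (g y ^+ 2).
pose H c := \int[pc c]_x ((\int[N x]_y g y) ^+ 2).
pose nu c := \int[pc c]_x \int[N x]_y g y.
pose k := 1 + (a / s) ^+ 2 * CP.
pose SA := \sum_c w c * A c; pose SH := \sum_c w c * H c; pose Sn := \sum_c w c * nu c.
rewrite [leLHS](_ : _ = SH - Sn ^+ 2)//.
rewrite [leRHS](_ : _ = (1 - r ^+ 2 * k^-1) * (SA - Sn ^+ 2))//.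
have mix : r ^+ 2 * (SA - Sn ^+ 2) <= \sum_c w c * (A c - nu c ^+ 2) :=
  mixture_within_variance s0 w0 w1 r0 r1 rho bg.
have k0 : 0 < k by rewrite ltr_pwDl// mulr_ge0// sqr_ge0.
have comp c : k^-1 * (A c - nu c ^+ 2) <= A c - H c.
  rewrite mulrC ler_pdivrMr//.
  have : H c - nu c ^+ 2 <= CP * (a / s) ^+ 2 * (A c - H c) :=
    poincare_normal_kernel (@pcP c) a0 s0 bg CP0.
  rewrite /k; lra.
have compS : k^-1 * (\sum_c w c * (A c - nu c ^+ 2)) <= SA - SH.
  rewrite /SA /SH -sumrB mulr_sumr; apply: ler_sum => c _.
  by rewrite mulrCA -mulrBr ler_wpM2l.
have ki0 : 0 <= k^-1 by rewrite invr_ge0 ltW.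
have := le_trans (ler_wpM2l ki0 mix) compS.
lra.
Qed.

End gaussian_mixture_contraction.

Theorem mainTheorem3 (R : realType) (d : nat) (C : finType)
    (pc : C -> probability 'rV[R]_d R) (CP T : R)
    (pc_density : forall c, exists q, is_density q (pc c))
    (pc_poincare : forall c, poincare (pc c) CP)
    (T_gt0 : 0 < T) :
  let alpha := expR (- T) in
  let bound : \bar R :=
    (expeR (- ((alpha / (4 * (1 - alpha)))%:E *
               \big[maxe/-oo]_(cc : C * C)
                 wasserstein2 (pc cc.1) (pc cc.2) ^+ 2)) *
     ((1 - alpha) / (1 - alpha + alpha * CP))%:E)%E in
  let forward : R.-pker 'rV[R]_d ~> 'rV[R]_d :=
    normal_kernel (Num.sqrt alpha) (Num.sqrt (1 - alpha)) in
  forall (w : C -> R) (p : probability 'rV[R]_d R)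
    (backward : R.-pker 'rV[R]_d ~> 'rV[R]_d),
    (forall c, 0 < w c) -> \sum_(c : C) w c = 1 ->
    is_mixture w pc p ->
    (exists q, is_density q p /\ class_C 1 q) ->
    is_conditional_law p forward backward ->
    (bound <= spectral_gap p (mkcomp_noparam forward backward))%E.
Proof.
move=> alpha bound forward w p backward w0 w1 pE _ pQK.
(* In dimension 0 the Poincare inequality holds for every constant, even a negative one, so the sign
   of [CP] is unknown; the gap is then [+oo]. *)
have [d0|d_gt0] := posnP d.
  by move: (spectral_gap_rV0); subst d => gapy; rewrite gapy leey.
have alpha0 : 0 < alpha by exact: expR_gt0.
have alpha1 : 0 < 1 - alpha by rewrite subr_gt0 -expR0 ltr_expR oppr_lt0.
(* Weights summing to 1 force an index to exist; it provides the sign of [CP] and rules out [-oo] as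
   the maximum. *)
have [c0 _] : exists c : C, True.
  apply: contrapT => C0; move: w1; rewrite big1 => [/esym/eqP|c _].
    by rewrite oner_eq0.
  by exfalso; apply: C0; exists c.
have CP0 : 0 <= CP by exact: poincare_ge0 (@pc_poincare c0) d_gt0.
pose a := Num.sqrt alpha; pose s := Num.sqrt (1 - alpha).
have a0 : a != 0 by rewrite sqrtr_eq0 -ltNge.
have s0 : 0 < s by rewrite sqrtr_gt0.
have asE : (a / s) ^+ 2 = alpha / (1 - alpha).
  by rewrite expr_div_n !sqr_sqrtr// ltW.
pose k := alpha / (4 * (1 - alpha)).
(* The doubling is the square of the affinity bound [r]. *)
have kE : k = (a / s) ^+ 2 / 8 *+ 2 by rewrite asE /k; field; rewrite gt_eqF.
have k0 : 0 < k by rewrite divr_gt0// mulr_gt0.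
pose kappa := (1 + (a / s) ^+ 2 * CP)^-1.
have kappaE : (1 - alpha) / (1 - alpha + alpha * CP) = kappa.
  rewrite /kappa asE; field; rewrite !gt_eqF//.
    by rewrite ltr_pwDl// mulr_ge0// ltW.
have kappa01 : 0 <= kappa <= 1.
  have h : 0 <= (a / s) ^+ 2 * CP by rewrite mulr_ge0 ?sqr_ge0.
  by rewrite invr_ge0 invf_le1 ?ltr_pwDl// addr_ge0//= lerDl.
have main r : 0 <= r -> r <= 1 ->
    (forall c c', (r%:E <= affinity a s (pc c) (pc c'))%E) ->
    ((r ^+ 2 * kappa)%:E <= spectral_gap p (mkcomp_noparam forward backward))%E.
  move=> r0 r1 rho; have /andP[kap0 kap1] := kappa01.
  have -> : r ^+ 2 * kappa = 1 - (1 - r ^+ 2 * kappa) by ring.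
  apply: (spectral_gap_ge pQK).
    by rewrite subr_ge0 mulr_ile1 ?sqr_ge0// expr_le1.
  by move=> g bg; exact: (mixture_contraction a0 s0 CP0 pc_poincare w0 w1 pE r0 r1 rho bg).
rewrite /bound kappaE -/k.
set M := \big[maxe/-oo%E]_(cc : C * C) _.
have leM c c' : (wasserstein2 (pc c) (pc c') ^+ 2 <= M)%E.
  exact: (@le_bigmax _ _ _ -oo%E (fun cc : C * C => wasserstein2 (pc cc.1) (pc cc.2) ^+ 2)%E (c, c')).
have M0 : (0 <= M)%E by rewrite (le_trans _ (leM c0 c0))// sqre_ge0.
case: M M0 leM => [m| |]//.
  rewrite lee_fin => m0 leM.
  have -> : (expeR (- (k%:E * m%:E)) * kappa%:E)%E =
      (expR (- ((a / s) ^+ 2 / 8 * m)) ^+ 2 * kappa)%:E.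
    have -> : expeR (- (k%:E * m%:E)) = (expR (- (k * m)))%:E by [].
    rewrite -EFinM; congr (_ * _)%:E.
    by rewrite [RHS]expr2 -expRD kE; congr expR; ring.
  apply: main.
  - exact: expR_ge0.
  - by rewrite -expR0 ler_expR oppr_le0 mulr_ge0// divr_ge0// sqr_ge0.
  - by move=> c c'; exact: expR_wasserstein_le_affinity.
move=> _ _.
(* If some distance is infinite the announced bound is 0, which is the case [r = 0]. *)
have -> : (expeR (- (k%:E * +oo)) * kappa%:E = (0 ^+ 2 * kappa)%:E)%E.
  by rewrite gt0_muley ?lte_fin//= mul0e expr0n mul0r.
apply: main => // c c'; apply: integral_ge0 => y _.
by rewrite lee_fin sqrtr_ge0.
Qed.
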